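(* Fix $c>0$ and consider weak, positive, single-humped solutions $u\in H^1(\mathbb{R})$ of the differential equation $c\,u=(1-bu^2)\,u''(x)$, in the sense defined in the context. For $b<0$ no such solutions exist. For each $b>0$ there exists a one-parameter continuous family of such solutions in the energy space $X$.
   Context: Here $c>0$ and $b\neq 0$ are real parameters and $u$ is real-valued. Weak solution: $u\in H^1(\mathbb{R})$ is a weak solution of $c u=(1-bu^2)u''$ if $$c\langle u,\varphi\rangle+\langle(1-bu^2)u',\varphi'\rangle-2b\langle u(u')^2,\varphi\rangle=0\quad\text{for every }\varphi\in H^1(\mathbb{R}),$$ where $\langle\cdot,\cdot\rangle$ is the standard inner product in $L^2(\mathbb{R})$ (the last term being understood as the integral $\int_{\mathbb{R}}u(u')^2\varphi\,dx$). The solution is positive if $u(x)>0$ for every $x\in\mathbb{R}$, and single-humped if there exists only one point $x_0\in\mathbb{R}$ such that $u(x_0)=\max_{x\in\mathbb{R}}u(x)$. Energy space: $$X=\left\{u\in H^1(\mathbb{R}):\ \left|\int_{\mathbb{R}}\log\bigl|1-b|u|^2\bigr|\,dx\right|<\infty\right\}.$$ The equation is invariant under translations in $x$; the one-parameter family is understood modulo translations (each member can be translated to be even in $x$), the parameter ranging over a continuum of real values. *)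

(* Defs.v *)
From mathcomp Require Import all_boot all_order all_algebra.
From mathcomp Require Import all_classical all_reals all_analysis.

Set Implicit Arguments.
Unset Strict Implicit.
Unset Printing Implicit Defensive.

Import Order.TTheory GRing.Theory Num.Theory.
Import numFieldNormedType.Exports.

Local Open Scope classical_set_scope.
Local Open Scope ring_scope.

Section Sobolev.
Variable R : realType.
Implicit Types u v phi : R -> R.

Definition inner_L2 u v : R := \int[lebesgue_measure]_x (u x * v x).

Definition is_C1c phi : Prop :=
  [/\ forall x, derivable phi x 1,
      continuous (derive1 phi)
    & compact (closure [set x | phi x != 0])].

(* As in Brezis, "Functional Analysis, Sobolev Spaces and PDE", Section 8.2,
   the test functions are C^1 with compact support; for locally integrable u
   and v, smooth test functions give the same notion by mollification. *)
Definition is_weak_derivative u v : Prop :=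
  forall phi, is_C1c phi -> inner_L2 u (derive1 phi) = - inner_L2 v phi.

(* [H1_with u v]: u is (a representative of) an element of H^1(R) and v is
   a representative of its weak derivative, which is unique only a.e. *)
Definition H1_with u v : Prop :=
  [/\ u \in Lfun (@lebesgue_measure R) 2%:E,
      v \in Lfun (@lebesgue_measure R) 2%:E
    & is_weak_derivative u v].

Definition in_H1 u : Prop := exists v, H1_with u v.

Definition norm_H1 u v : R := Num.sqrt (inner_L2 u u + inner_L2 v v).

Definition H1_continuous_family (U : R -> R -> R) : Prop :=
  exists V : R -> R -> R, (forall t, H1_with (U t) (V t)) /\
    forall t0 : R, norm_H1 (U t \- U t0) (V t \- V t0) @[t --> t0] --> (0 : R).

(* All three integrands are integrable, since functions in H^1(R) are
   essentially bounded. *)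
Definition weak_solution (c b : R) u : Prop :=
  exists2 v, H1_with u v &
    forall phi psi, H1_with phi psi ->
      c * inner_L2 u phi
      + inner_L2 (fun x => (1 - b * u x ^+ 2) * v x) psi
      - 2 * b * \int[lebesgue_measure]_x (u x * v x ^+ 2 * phi x) = 0.

Definition positive_fun u : Prop := forall x, 0 < u x.

Definition single_humped u : Prop :=
  exists! x0, forall x, u x <= u x0.

(* Pointwise properties of an element of H^1(R) refer to its continuous
   representative, hence the continuity requirement. *)
Definition positive_single_humped_solution (c b : R) u : Prop :=
  [/\ continuous u, weak_solution c b u, positive_fun u & single_humped u].

(* [lne 0 = -oo]; moreover [+oo - +oo = -oo] in [\bar R], so that finiteness of
   the integral means that both the positive and the negative parts of the
   logarithm have a finite integral. *)
Definition energy_space (b : R) u : Prop :=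
  in_H1 u /\
  (`| \int[lebesgue_measure]_x lne (`|1 - b * `|u x| ^+ 2|%R%:E) | < +oo)%E.

End Sobolev.

(* Main.v *)
(* For b < 0, testing the weak formulation with u itself gives a sum of
   nonnegative terms equal to 0, so that u = 0 almost everywhere.

   For b > 0, put c = k^2 and b = m^2. With q = - (m / k) u' the equation has
   the first integral m^2 u^2 - 1 = A exp (- q^2), where the constant A can
   change where m^2 u^2 = 1, that is, where q is infinite. The parameter r with
   q = exp r or q = exp (- r) turns the pieces of solution into curves, x being
   a primitive of an explicit density. The wave of parameter t is the crest
   with A = exp t on a bounded interval, glued to the two tails with A = -1.

   At the gluing points u' is infinite, but the flux (1 - b u^2) u', which is
   proportional to A exp (- q^2) q, is continuous and vanishes. Its derivative
   off the gluing points is square integrable, and integrating by parts gives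
   the weak formulation. Along the curves, the integrals over x of functions
   of q become integrals over r, with integrands Lipschitz in A; the norms of u
   and u' are thus continuous in A, and with pointwise convergence this gives
   continuity in H^1, as in Scheffe's lemma. Different members of the family
   have different maxima, m^2 (max u)^2 = 1 + A. *)
Require Import Defs.
From mathcomp Require Import all_boot all_order all_algebra.
From mathcomp Require Import all_classical all_reals all_analysis.
From mathcomp Require Import measurable_realfun ring lra.
Set Implicit Arguments.
Unset Strict Implicit.
Unset Printing Implicit Defensive.
Import Order.TTheory GRing.Theory Num.Theory.
Import numFieldNormedType.Exports.
Local Open Scope classical_set_scope.
Local Open Scope ring_scope.

(** * Calculus *)

Section Calculus.
Variable R : realType.
Implicit Types (f g F G : R -> R) (a b x : R).
Notation mu := (@lebesgue_measure R).

(** Multiplying u'' = c u / (1 - b u^2) by u' and integrating gives q^2 + log|1 - b u^2| = const,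
    with |A| = exp const. Decay of u and u' at infinity forces A = -1 on the tails. At the crest q =
    0 leaves A > 0 free, and since the flux vanishes at the gluing points nothing ties the two
    constants together: this is where the family comes from. Differentiating the first integral,
    with m u = sqrt(1 + A exp(-q^2)) and m u' = - k q, gives dx = A exp(-q^2) dq / (k m u). In the
    variable q the tail has a logarithmic divergence at q = 0. With r as parameter, both pieces
    become curves over the whole real line with positive speed, whose ends are suprema and infima.
    Integrals along them are estimated, not computed: integrands are compared with q / (1 + q^2),
    whose primitive in r is a bounded arctangent. *)

Lemma is_derive_continuous f x d : is_derive x 1 f d -> {for x, continuous f}.
Proof. by move=> [df _]; apply/differentiable_continuous/derivable1_diffP. Qed.

Lemma is_deriveMp f g x df dg : is_derive x 1 f df -> is_derive x 1 g dg ->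
  is_derive x 1 (fun y => f y * g y) (df * g x + f x * dg).
Proof.
move=> hf hg; have := is_deriveM hf hg; rewrite /GRing.scale/= addrC [g x * _]mulrC.
exact.
Qed.

Lemma is_deriveDp f g x df dg : is_derive x 1 f df -> is_derive x 1 g dg ->
  is_derive x 1 (fun y => f y + g y) (df + dg).
Proof. exact: is_deriveD. Qed.

Lemma is_deriveBp f g x df dg : is_derive x 1 f df -> is_derive x 1 g dg ->
  is_derive x 1 (fun y => f y - g y) (df - dg).
Proof. exact: is_deriveB. Qed.

Lemma is_deriveZp f c x df : is_derive x 1 f df ->
  is_derive x 1 (fun y => c * f y) (c * df).
Proof. by move=> hf; exact: (is_deriveZ c hf). Qed.

Lemma is_derive_comp f g x d df : is_derive (g x) 1 f d -> is_derive x 1 g df ->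
  is_derive x 1 (fun y => f (g y)) (d * df).
Proof. by move=> hf hg; exact: is_derive1_comp. Qed.

Lemma is_derive_idp x : is_derive x 1 (fun y : R => y) (1 : R).
Proof. exact: is_derive_id. Qed.

Lemma is_derive_cstp (c x : R) : is_derive x 1 (fun _ : R => c) (0 : R).
Proof. exact: is_derive_cst. Qed.

Lemma is_derive_norm x : x != 0 -> is_derive x 1 (fun y : R => `|y|) (Num.sg x).
Proof.
rewrite neq_lt => /orP[x0|x0].
  rewrite ltr0_sg//.
  apply: near_eq_is_derive (is_deriveNid x (1 : R)).
  apply: filterS (lt_nbhsl x0) => y y0; by rewrite ltr0_norm.
rewrite gtr0_sg//.
apply: near_eq_is_derive (is_derive_idp x).
by apply: filterS (lt_nbhsr x0) => y y0; rewrite gtr0_norm.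
Qed.

Lemma near_sg x : x != 0 -> \forall y \near x, Num.sg y = Num.sg x.
Proof.
rewrite neq_lt => /orP[x0|x0].
  by apply: filterS (lt_nbhsl x0) => y y0; rewrite !ltr0_sg.
by apply: filterS (lt_nbhsr x0) => y y0; rewrite !gtr0_sg.
Qed.

(** The mean value theorem for [G - F]. Comparing increments through derivatives replaces integral
    estimates in most bounds on primitives below. *)
Lemma ler_incr_derive F G f g a b : a <= b ->
  (forall x, a <= x <= b -> is_derive x 1 F (f x)) ->
  (forall x, a <= x <= b -> is_derive x 1 G (g x)) ->
  (forall x, a <= x <= b -> f x <= g x) -> F b - F a <= G b - G a.
Proof.
move=> ab dF dG fg.
have [||c] := @MVT_segment R (G \- F) (g \- f) a b ab.
- by move=> x; rewrite in_itv/= => /andP[ax xb]; apply: is_deriveB;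
    [apply: dG|apply: dF]; rewrite !ltW.
- apply: continuous_in_subspaceT => x; rewrite inE/= in_itv/= => xab.
  by apply: continuousB; apply: is_derive_continuous; [exact: dG|exact: dF].
rewrite in_itv/= => cab /= e; rewrite -subr_ge0.
suff -> : G b - G a - (F b - F a) = (g c - f c) * (b - a).
  by rewrite mulr_ge0 ?subr_ge0// fg.
by rewrite -e; ring.
Qed.

Lemma ger0_derive_le F f a b : a <= b ->
  (forall x, a <= x <= b -> is_derive x 1 F (f x)) ->
  (forall x, a <= x <= b -> 0 <= f x) -> F a <= F b.
Proof.
move=> ab dF f0; rewrite -subr_ge0 -[leLHS](subrr 0).
apply: (@ler_incr_derive (cst 0) F (cst 0) f a b ab) => // x _.
Qed.

Lemma ltr_incr_derive F f a b : a < b ->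
  (forall x, a <= x <= b -> is_derive x 1 F (f x)) ->
  (forall x, a <= x <= b -> 0 < f x) -> F a < F b.
Proof.
move=> ab dF f0.
have [||c] := @MVT_segment R F f a b (ltW ab).
- by move=> x; rewrite in_itv/= => /andP[ax xb]; apply: dF; rewrite !ltW.
- apply: continuous_in_subspaceT => x; rewrite inE/= in_itv/= => xab.
  by apply: is_derive_continuous; exact: dF.
rewrite in_itv/= => cab /= e.
by rewrite -subr_gt0 e mulr_gt0 ?subr_gt0// f0.
Qed.

(** The oriented integral of [f] from 0 to x. Integrals over sets carry no orientation, so both
    start at a base point to the left of 0 and x, which for continuous [f] cancels in the
    difference. *)
Definition primitive f x : R :=
  \int[mu]_(t in `[- (`|x| + 1), x]) f t
  - \int[mu]_(t in `[- (`|x| + 1), 0]) f t.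

Lemma continuous_integrable_itv f a b : continuous f ->
  mu.-integrable `[a, b] (EFin \o f).
Proof.
move=> cf; apply: continuous_compact_integrable; first exact: segment_compact.
exact: continuous_subspaceT.
Qed.

(** The base point in [primitive] moves with x; freezing it is what makes differentiation at x
    possible. *)
Lemma primitive_from f a x : continuous f -> a <= x -> a <= 0 ->
  primitive f x = \int[mu]_(t in `[a, x]) f t - \int[mu]_(t in `[a, 0]) f t.
Proof.
move=> cf ax a0.
(* The right-hand side does not mention [c], so any two base points give the same difference. *)
suff H c : c <= x -> c <= 0 ->
    \int[mu]_(t in `[c, x]) f t - \int[mu]_(t in `[c, 0]) f t =
    if 0 <= x then \int[mu]_(t in `]0, x]) f t else
    - \int[mu]_(t in `]x, 0]) f t.
  by rewrite /primitive !H//; have := ler_norm (- x); rewrite normrN => h; lra.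
move=> cx c0; case: ifPn => [x0|].
  by rewrite Rintegral_itvB ?bnd_simp//; exact: continuous_integrable_itv.
rewrite -ltNge => x0; rewrite -opprB; congr (- _).
rewrite Rintegral_itvB ?bnd_simp ?(ltW x0)//; exact: continuous_integrable_itv.
Qed.

Lemma primitive0 f : primitive f 0 = 0.
Proof. by rewrite /primitive normr0 subrr. Qed.

Lemma is_derive_primitive f x : continuous f -> is_derive x 1 (primitive f) (f x).
Proof.
move=> cf; set a := - (`|x| + 1).
have ax : a < x by rewrite /a; have := ler_norm (- x); rewrite normrN => h; lra.
have a0 : a < 0 by rewrite /a; have := normr_ge0 x => h; lra.
have [dF dFE] : derivable (fun y => \int[mu]_(t in `[a, y]) f t) x 1 /\
    derive1 (fun y => \int[mu]_(t in `[a, y]) f t) x = f x.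
  apply: (@continuous_FTC1 _ f (BLeft a) x (x + 1)) => //.
  - by rewrite ltrDl.
  - exact: continuous_integrable_itv.
  - exact: cf.
pose c := \int[mu]_(t in `[a, 0]) f t.
have H : is_derive x 1 ((fun y => \int[mu]_(t in `[a, y]) f t) \- cst c) (f x).
  rewrite -[f x]subr0; apply: is_deriveB.
  by split; [exact: dF|rewrite -derive1E].
apply: near_eq_is_derive H.
near=> y; rewrite (@primitive_from _ a)//; last exact: ltW.
by apply/ltW; near: y; exact: lt_nbhsr.
Unshelve. all: by end_near. Qed.

End Calculus.

(** * Flattening at finitely many values *)

Section Cutoff.
Variable R : realType.
Implicit Types (Z : seq R) (n : nat) (s z x y : R).

Lemma near_natS_ge x : \forall n \near \oo, x <= n.+1%:R.
Proof.
exists (Num.truncn x) => // n /= xn.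
by apply/ltW/(lt_le_trans (truncnS_gt _)); rewrite ler_nat.
Qed.

Definition clamp01 x : R := Num.min 1 (Num.max 0 x).

(** The factor of z vanishes for |s - z| <= 1/(n+1) and equals 1 for |s - z| >= 2/(n+1). *)
Definition cutoff Z n s : R :=
  \prod_(z <- Z) clamp01 (n.+1%:R * `|s - z| - 1).

Lemma clamp01_bound x : 0 <= clamp01 x <= 1.
Proof. by rewrite /clamp01 ge_min lexx/= andbT le_min ler01 le_max lexx. Qed.

Lemma clamp01_eq0 x : x <= 0 -> clamp01 x = 0.
Proof.
by move=> x0; rewrite /clamp01 (max_idPl x0); apply/min_idPr.
Qed.

Lemma clamp01_eq1 x : 1 <= x -> clamp01 x = 1.
Proof. by move=> x1; apply/min_idPl; rewrite le_max x1 orbT. Qed.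

Lemma continuous_clamp01 : continuous clamp01.
Proof.
move=> x; apply: continuous_min; first exact: cvg_cst.
by apply: continuous_max; [exact: cvg_cst|exact: cvg_id].
Qed.

Lemma cutoff_bound Z n s : 0 <= cutoff Z n s <= 1.
Proof.
rewrite /cutoff; elim: Z => [|z Z IH]; first by rewrite big_nil ler01 lexx.
rewrite big_cons; have /andP[a b] := clamp01_bound (n.+1%:R * `|s - z| - 1).
by case/andP: IH => c d; rewrite mulr_ge0//= mulr_ile1.
Qed.

Lemma cutoff_eq0 Z n s z : z \in Z -> `|s - z| <= n.+1%:R^-1 ->
  cutoff Z n s = 0.
Proof.
move=> zZ sz; apply/eqP; rewrite prodf_seq_eq0; apply/hasP; exists z => //=.
by rewrite clamp01_eq0// subr_le0 mulrC -ler_pdivlMr// mul1r.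
Qed.

Lemma continuous_cutoff Z n : continuous (cutoff Z n).
Proof.
elim: Z => [|z Z IH] x.
  have -> : cutoff [::] n = cst 1 by apply/funext => s; rewrite /cutoff big_nil.
  exact: cvg_cst.
have -> : cutoff (z :: Z) n =
    (fun s => clamp01 (n.+1%:R * `|s - z| - 1)) \* cutoff Z n.
  by apply/funext => s; rewrite /cutoff big_cons.
apply: continuousM; last exact: IH.
apply: (@continuous_comp _ _ _ (fun s : R => n.+1%:R * `|s - z| - 1) clamp01);
  last exact: continuous_clamp01.
apply: cvgB; last exact: cvg_cst.
apply: cvgM; first exact: cvg_cst.
by apply: cvg_norm; apply: cvgB; [exact: cvg_id|exact: cvg_cst].
Qed.

(** For factors in [0, 1], one minus the product is at most the sum of the deficits. A factor below
    1 has w = (n+1)|s - z| < 2, so 1 + w^2 < 5: hence the 5. The bound has an explicit primitive, a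
    sum of arctangents. *)
Lemma cutoff_lower Z n s :
  1 - cutoff Z n s <= \sum_(z <- Z) 5 / (1 + (n.+1%:R * (s - z)) ^+ 2).
Proof.
rewrite /cutoff; elim: Z => [|z Z IH]; first by rewrite !big_nil subrr.
rewrite !big_cons; set c := clamp01 _; set P := \prod_(_ <- _) _ in IH *.
have /andP[c0 c1] : 0 <= c <= 1 := clamp01_bound _.
have /andP[P0 P1] : 0 <= P <= 1 := cutoff_bound Z n s.
suff H : 1 - c <= 5 / (1 + (n.+1%:R * (s - z)) ^+ 2).
  have : 1 - c * P <= 1 - c + (1 - P) by nra.
  by move=> h; apply: (le_trans h); exact: lerD.
have D0 : 0 < 1 + (n.+1%:R * (s - z)) ^+ 2 by have := sqr_ge0 (n.+1%:R * (s - z)); lra.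
have [h|h] := leP 1 (n.+1%:R * `|s - z| - 1).
  by rewrite /c clamp01_eq1// subrr divr_ge0// ltW.
rewrite (@le_trans _ _ 1)//; first by rewrite gerBl.
rewrite ler_pdivlMr// mul1r -real_normK ?num_real// normrM normr_nat.
have : 0 <= n.+1%:R * `|s - z| by rewrite mulr_ge0.
move: h; set w := _ * `|_|; nra.
Qed.

Lemma cutoff_cvg1 Z s : s \notin Z -> cutoff Z n s @[n --> \oo] --> (1 : R).
Proof.
elim: Z => [|z Z IH].
  move=> _; rewrite (_ : (fun n => _) = cst 1); first exact: cvg_cst.
  by apply/funext => n; rewrite /cutoff big_nil.
rewrite inE negb_or => /andP[sz /IH H].
rewrite (_ : (fun n => _) =
    (fun n => clamp01 (n.+1%:R * `|s - z| - 1)) \* (cutoff Z ^~ s)); last first.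
  by apply/funext => n; rewrite /cutoff big_cons.
rewrite -[1]mulr1; apply: cvgM => //.
apply: cvg_near_cst; near=> n; apply: clamp01_eq1.
suff : 2%:R <= n.+1%:R * `|s - z| by lra.
rewrite -ler_pdivrMr ?normr_gt0 ?subr_eq0//.
by near: n; exact: near_natS_ge.
Unshelve. all: by end_near. Qed.

Definition flatten_at Z n : R -> R := primitive (cutoff Z n).

Lemma is_derive_flatten Z n s :
  is_derive s 1 (flatten_at Z n) (cutoff Z n s).
Proof. exact/is_derive_primitive/continuous_cutoff. Qed.

Lemma flatten_at0 Z n : flatten_at Z n 0 = 0.
Proof. exact: primitive0. Qed.

Lemma norm_flatten_le Z n s : `|flatten_at Z n s| <= `|s|.
Proof.
have H a b : a <= b ->
    0 <= flatten_at Z n b - flatten_at Z n a <= b - a.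
  move=> ab; apply/andP; split.
    rewrite subr_ge0.
    apply: (@ger0_derive_le R _ (cutoff Z n) a b ab) => x _.
      exact: is_derive_flatten.
    by case/andP: (cutoff_bound Z n x).
  apply: (@ler_incr_derive R _ id (cutoff Z n) (cst 1) a b ab) => x _.
  - exact: is_derive_flatten.
  - by case/andP: (cutoff_bound Z n x).
have [s0|s0] := leP 0 s.
  have := H _ _ s0; rewrite flatten_at0 !subr0 => /andP[a b].
  by rewrite !ger0_norm.
have := H _ _ (ltW s0); rewrite flatten_at0 !sub0r => /andP[a b].
by rewrite -normrN -[leRHS]normrN !ger0_norm// oppr_ge0 ltW.
Qed.

(* Near z, 1 - cutoff is dominated by the derivative of
   5/(n+1) atan((n+1)(s - z)), which is uniformly small. *)
Lemma flatten_cvg Z s : flatten_at Z n s @[n --> \oo] --> s.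
Proof.
pose G n s := \sum_(z <- Z) 5 / n.+1%:R * atan (n.+1%:R * (s - z)).
have dG n x : is_derive x 1 (G n) (\sum_(z <- Z) 5 / (1 + (n.+1%:R * (x - z)) ^+ 2)).
  rewrite /G; elim: Z {G} => [|z Z IH].
    rewrite big_nil (_ : (fun s => _) = cst 0); last first.
      by apply/funext => y; rewrite big_nil.
    exact: is_derive_cst.
  rewrite big_cons (_ : (fun s => _) =
      (fun s => 5 / n.+1%:R * atan (n.+1%:R * (s - z))) \+
      (fun s => \sum_(z <- Z) 5 / n.+1%:R * atan (n.+1%:R * (s - z)))); last first.
    by apply/funext => y; rewrite big_cons.
  apply: is_deriveD.
  rewrite (_ : 5 / (1 + _) = 5 / n.+1%:R *
      ((1 + (n.+1%:R * (x - z)) ^+ 2)^-1 * n.+1%:R)); last first.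
    by rewrite [_^-1 * n.+1%:R]mulrC mulrA divfK.
  apply: is_deriveZp; apply: (@is_derive_comp R atan _ _ _ n.+1%:R).
  rewrite -[X in is_derive _ _ _ X]mulr1 -[X in _ * X](subr0 1).
  by apply: is_deriveZp; apply: is_deriveBp.
have H n a b : a <= b -> 0 <= (b - flatten_at Z n b) - (a - flatten_at Z n a)
    <= G n b - G n a.
  move=> ab; have dI x : is_derive x 1 (id \- flatten_at Z n) (1 - cutoff Z n x).
    by apply: is_deriveB; exact: is_derive_flatten.
  apply/andP; split.
    rewrite subr_ge0.
    apply: (@ger0_derive_le R (id \- flatten_at Z n) _ a b ab (fun x _ => dI x)) => x _.
    by rewrite subr_ge0; case/andP: (cutoff_bound Z n x).
  apply: (@ler_incr_derive R (id \- flatten_at Z n) (G n) _ _ a b ab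
    (fun x _ => dI x) (fun x _ => dG n x)) => x _.
  exact: cutoff_lower.
have K n : `|s - flatten_at Z n s| <= `|G n s - G n 0|.
  have [s0|s0] := leP 0 s.
    have := H n _ _ s0; rewrite flatten_at0 !subr0 => /andP[a b].
    by rewrite ger0_norm// (le_trans b)// ler_norm.
  have := H n _ _ (ltW s0); rewrite flatten_at0 subrr sub0r => /andP[a b].
  by rewrite -normrN ger0_norm// (le_trans b)// distrC ler_norm.
(* |atan| < pi/2 < 2 turns the coefficient 5 into 10. *)
have B n y : `|G n y| <= (size Z)%:R * (10 / n.+1%:R).
  rewrite /G; elim: Z {dG H K G} => [|z Z IH]; first by rewrite big_nil mul0r normr0.
  rewrite big_cons; set c := _ * atan _; set C := \sum_(_ <- _) _ in IH *.
  have hc : `|c| <= 10 / n.+1%:R.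
    rewrite /c normrM [`|5 / _|]ger0_norm ?divr_ge0// (_ : 10 = 5 * 2 :> R); last by ring.
    rewrite (mulrAC 5 2) ler_wpM2l ?divr_ge0//.
    have := @pihalf_lt2 R; have := atan_ltpi2 (n.+1%:R * (y - z)).
    have := atan_gtNpi2 (n.+1%:R * (y - z)).
    by rewrite ler_norml; lra.
  rewrite [size (z :: Z)]/= -[(size Z).+1%:R]natr1 mulrDl mul1r addrC.
  by rewrite (le_trans (ler_normD _ _))// lerD.
apply/cvgrPdist_le => e e0; near=> n.
rewrite (le_trans (K n))// (le_trans (ler_normB _ _))// (le_trans (lerD (B n s) (B n 0)))//.
rewrite (_ : _ + _ = (size Z)%:R * 10 * 2 / n.+1%:R); last first.
  by set w := n.+1%:R^-1; ring.
rewrite ler_pdivrMr// [e * _]mulrC -ler_pdivrMr//.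
by near: n; exact: near_natS_ge.
Unshelve. all: by end_near. Qed.

Lemma flatten_cst Z n z s s' : z \in Z ->
  `|s - z| <= n.+1%:R^-1 -> `|s' - z| <= n.+1%:R^-1 ->
  flatten_at Z n s = flatten_at Z n s'.
Proof.
move=> zZ; wlog ss' : s s' / s <= s'.
  move=> H; have [/H //|/ltW/H h a b] := leP s s'.
  by rewrite h.
rewrite !ler_distl => /andP[s1 s2] /andP[s'1 s'2]; apply/eqP.
have E x : s <= x <= s' -> cutoff Z n x = 0.
  move=> /andP[sx xs']; apply: (cutoff_eq0 zZ).
  by rewrite ler_distl (le_trans s1 sx) (le_trans xs' s'2).
rewrite eq_le; apply/andP; split.
  apply: (@ger0_derive_le R _ (cutoff Z n) _ _ ss') => x xs.
    exact: is_derive_flatten.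
  by rewrite E.
have := @ler_incr_derive R (flatten_at Z n) (cst 0) (cutoff Z n) (cst 0) _ _ ss'.
rewrite subrr subr_le0; apply => x xs //; first exact: is_derive_flatten.
by rewrite E.
Qed.

End Cutoff.

(** * Weak derivatives of functions with finitely many kinks *)

Section AlmostEverywhere.
Variable R : realType.
Notation mu := (@lebesgue_measure R).
Implicit Types (S : seq R) (f g : R -> R).

Lemma measurable_seq S : measurable [set` S].
Proof. apply: countable_measurable; first by move=> x; exact: measurable_set1.
exact/finite_set_countable/finite_seq. Qed.

Lemma ae_off_seq S (P : R -> Prop) : (forall x, x \notin S -> P x) ->
  {ae mu, forall x, P x}.
Proof.
move=> H; exists [set` S]; split; first exact: measurable_seq.
  by apply: countable_lebesgue_measure0; exact/finite_set_countable/finite_seq.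
by move=> x /= nP; apply: contrapT => /negP xS; apply: nP; exact: H.
Qed.

Lemma measurable_continuous_off S f :
  (forall x, x \notin S -> {for x, continuous f}) -> measurable_fun setT f.
Proof.
move=> cf; rewrite -(setUv [set` S]).
apply: (measurable_funU f (measurable_seq S) (measurableC (measurable_seq S))).2.
split.
  move=> _ Y mY; apply: countable_measurable; first by move=> x; exact: measurable_set1.
  by apply: (@sub_countable _ _ _ [set` S]);
    [apply: subset_card_le; exact: subIsetl|exact/finite_set_countable/finite_seq].
apply: open_continuous_measurable_fun.
  apply: closed_openC.
  apply: (accessible_finite_set_closed.1 (hausdorff_accessible (@Rhausdorff R))).
  exact: finite_seq.
by move=> x; rewrite inE/= => /negP; exact: cf.
Qed.

Lemma measurable_eq_off (S : seq R) (f g : R -> \bar R) : measurable_fun setT g ->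
  (forall x, x \notin S -> f x = g x) -> measurable_fun setT f.
Proof.
move=> mg fg; rewrite -(setUv [set` S]).
apply: (measurable_funU f (measurable_seq S) (measurableC (measurable_seq S))).2.
split.
  move=> _ Y mY; apply: countable_measurable; first by move=> x; exact: measurable_set1.
  by apply: (@sub_countable _ _ _ [set` S]);
    [apply: subset_card_le; exact: subIsetl|exact/finite_set_countable/finite_seq].
apply: (eq_measurable_fun g); last exact: measurable_funTS.
by move=> x; rewrite inE/= => /negP/fg.
Qed.

Lemma integrable_eq_off (S : seq R) (f g : R -> \bar R) :
  (forall x, x \notin S -> f x = g x) ->
  mu.-integrable setT g -> mu.-integrable setT f.
Proof.
move=> fg ig; have mg := measurable_int mu ig.
have mf := measurable_eq_off mg fg; apply/integrableP; split; first exact: mf.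
have -> : (\int[mu]_x `|f x| = \int[mu]_x `|g x|)%E.
  apply: ae_eq_integral => //; [exact: measurableT_comp|exact: measurableT_comp|].
  by apply: (@ae_off_seq S) => x xS _; rewrite fg.
by have /integrableP[] := ig.
Qed.

Lemma integral_eq_off (S : seq R) (f g : R -> \bar R) : measurable_fun setT g ->
  (forall x, x \notin S -> f x = g x) ->
  (\int[mu]_x f x = \int[mu]_x g x)%E.
Proof.
move=> mg fg; apply: ae_eq_integral => //; first exact: measurable_eq_off fg.
by apply: (@ae_off_seq S) => x xS _; rewrite fg.
Qed.

Lemma Rintegral_dominated S (f_ : nat -> R -> R) f (G : R -> R) :
  (forall n, measurable_fun setT (f_ n)) -> measurable_fun setT f ->
  mu.-integrable setT (EFin \o G) ->
  (forall x, x \notin S -> f_ n x @[n --> \oo] --> f x) ->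
  (forall n x, `|f_ n x| <= G x) ->
  \int[mu]_x f_ n x @[n --> \oo] --> \int[mu]_x f x.
Proof.
move=> mf_ mf iG cvg_f bnd.
have [|||||intf _ H] := @dominated_convergence _ _ _ mu setT measurableT
    (fun n => EFin \o f_ n) (EFin \o f) (EFin \o G).
- by move=> n; apply/measurable_EFinP; exact: mf_.
- exact/measurable_EFinP.
- apply: (@ae_off_seq S) => x xS _; apply: cvg_EFin; last exact: cvg_f.
  exact: nearW.
- exact: iG.
- by apply: aeW => x n _ /=; rewrite lee_fin.
have := H; rewrite -[X in _ --> X -> _]fineK; last exact: integrable_fin_num.
by move/fine_cvgP => [].
Qed.

Lemma Lfun2P f : measurable_fun setT f ->
  mu.-integrable setT (EFin \o (fun x => f x ^+ 2)) -> f \in Lfun mu 2%:E.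
Proof.
move=> mf /integrableP[_ intf]; rewrite inE; apply/andP; split; first by rewrite inE.
rewrite inE/= /finite_norm unlock.
have E : (\int[mu]_x (`|(f x)%:E| `^ 2) = \int[mu]_x `|(f x ^+ 2)%:E|)%E.
  by apply: eq_integral => x _ /=; rewrite powR_mulrn// normrX.
rewrite E poweR_lty//.
Qed.

Lemma Lfun2_measurable f : f \in Lfun mu 2%:E -> measurable_fun setT f.
Proof. by rewrite inE => /andP[/[!inE]/=]. Qed.

Lemma Lfun2_integrableM f g : f \in Lfun mu 2%:E -> g \in Lfun mu 2%:E ->
  mu.-integrable setT (EFin \o (fun x => f x * g x)).
Proof. by move=> hf hg; apply/Lfun1_integrable; exact: Lfun2_mul_Lfun1. Qed.

Lemma integrable_scale (f : R -> R) a : mu.-integrable setT (EFin \o f) ->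
  mu.-integrable setT (EFin \o (fun x => a * f x)).
Proof. by move=> /(integrableZl measurableT a). Qed.

Lemma Lfun2_scale (f : R -> R) a : f \in Lfun mu 2%:E ->
  (fun x => a * f x) \in Lfun mu 2%:E.
Proof.
move=> Lf; apply: Lfun2P.
  by apply: measurable_funM; [exact: measurable_cst|exact: Lfun2_measurable].
have -> : (fun x => (a * f x) ^+ 2) = (fun x => a ^+ 2 * f x ^+ 2).
  by apply/funext => x; rewrite exprMn.
exact/integrable_scale/Lfun2_integrable_sqr.
Qed.

End AlmostEverywhere.

(** * Integration by parts against functions of H^1 *)

Section WeakDerivative.
Variable R : realType.
Notation mu := (@lebesgue_measure R).
Implicit Types (S : seq R) (f g phi psi : R -> R) (x N : R).

Definition vanishes_at_infinity f :=
  forall e : R, 0 < e -> exists N : R, forall x, N <= `|x| -> `|f x| < e.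

Lemma compact_closure_bounded (A : set R) N :
  (forall x, A x -> `|x| <= N) -> compact (closure A).
Proof.
move=> AN; apply: (@subclosed_compact _ _ `[-N, N]); first exact: closed_closure.
  exact: segment_compact.
have /closure_id -> : closed `[-N, N] by exact: itv_closed.
apply: closure_subset => x /AN; rewrite /= in_itv/= ler_norml//.
Qed.

(* f is allowed to have infinite slope on S, but its values there are
   exceptional: composing f with functions that are flat near 0 and near f(S)
   gives C^1 functions of compact support, which converge to f. *)
Lemma weak_by_parts S f g phi psi :
  continuous f -> vanishes_at_infinity f ->
  (forall x, x \notin S -> is_derive x 1 f (g x)) ->
  (forall x, x \notin S -> {for x, continuous g}) ->
  (forall x, x \notin S -> f x \notin 0 :: map f S) ->
  f \in Lfun mu 2%:E -> g \in Lfun mu 2%:E ->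
  phi \in Lfun mu 2%:E -> psi \in Lfun mu 2%:E -> is_weak_derivative phi psi ->
  inner_L2 f psi = - inner_L2 g phi.
Proof.
move=> cf f0 df cg fS Lf Lg Lphi Lpsi wphi.
set Z := 0 :: map f S.
pose eta n := flatten_at Z n \o f.
pose deta n x := cutoff Z n (f x) * g x.
have n0 n : 0 < n.+1%:R^-1 :> R by rewrite invr_gt0.
have nearS n x : x \in S ->
    \forall y \near x, `|f y - f x| <= n.+1%:R^-1.
  move=> xS; have /cvgrPdist_le/(_ _ (n0 n)) := cf x.
  by apply: filterS => y; rewrite distrC.
have fxZ x : x \in S -> f x \in Z.
  by move=> xS; rewrite inE map_f ?orbT.
have d_eta n x : is_derive x 1 (eta n) (deta n x).
  have [xS|xS] := boolP (x \in S); last first.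
    by apply: is_derive_comp; [exact: is_derive_flatten|exact: df].
  rewrite /deta (cutoff_eq0 (fxZ _ xS)) ?subrr ?normr0 ?ltW// mul0r.
  apply: (near_eq_is_derive (f := cst (eta n x))).
  apply: filterS (nearS n x xS) => y fy /=.
  by apply: (flatten_cst (fxZ _ xS)) => //; rewrite subrr normr0 ltW.
(* At a point of [S] the cutoff vanishes on a whole neighbourhood, so [deta n] is continuous there
   however badly [g] behaves. *)
have c_deta n : continuous (deta n).
  move=> x; have [xS|xS] := boolP (x \in S); last first.
    apply: cvgM; last exact: cg.
    by apply: continuous_comp; [exact: cf|exact: continuous_cutoff].
  rewrite /continuous_at {2}/deta (cutoff_eq0 (fxZ _ xS)) ?subrr ?normr0 ?ltW// mul0r.
  apply: cvg_near_cst; apply: filterS (nearS n x xS) => y fy.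
  by rewrite /deta (cutoff_eq0 (fxZ _ xS))// mul0r.
have E n : derive1 (eta n) = deta n.
  by apply/funext => x; rewrite derive1E; case: (d_eta n x).
have C1 n : is_C1c (eta n).
  split.
  - by move=> x; case: (d_eta n x).
  - by rewrite E.
  - have [N HN] := f0 _ (n0 n).
    apply: (@compact_closure_bounded _ N) => x; apply: contraPP => /negP.
    rewrite -ltNge => Nx; apply/negP; rewrite negbK.
    rewrite /eta/= -(flatten_at0 Z n).
    rewrite (@flatten_cst _ Z n 0 (f x) 0)// ?mem_head// subr0 ?normr0 ?ltW//.
    exact/HN/ltW.
(* [eta n] is the test function in the definition of the weak derivative of [phi], so [phi] itself
   is never approximated. *)
have H n : inner_L2 phi (deta n) = - inner_L2 psi (eta n).
  by rewrite -E; exact: wphi.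
have mf := continuous_measurable_fun cf.
have [mg mphi mpsi] : [/\ measurable_fun setT g, measurable_fun setT phi & measurable_fun setT psi].
  by split; exact: Lfun2_measurable.
have c_eta n : continuous (eta n).
  by move=> x; exact: is_derive_continuous (d_eta n x).
(* Dominated by |g phi|: the cutoff lies in [0, 1], and off [S] it tends to 1 because [f x] avoids 0
   and the values of [f] on [S]. *)
have L1 : inner_L2 phi (deta n) @[n --> \oo] --> inner_L2 g phi.
  apply: (@Rintegral_dominated _ S _ _ (fun x => `|g x * phi x|)).
  - by move=> n; apply: measurable_funM => //; exact: continuous_measurable_fun.
  - exact: measurable_funM.
  - exact/integrable_norm/Lfun2_integrableM.
  - move=> x xS; rewrite mulrC; apply: cvgM; first exact: cvg_cst.
    rewrite -[X in _ --> X]mul1r; apply: cvgM; last exact: cvg_cst.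
    exact/cutoff_cvg1/fS.
  - move=> n x; rewrite /deta mulrCA normrM mulrC [g x * _]mulrC.
    rewrite -[leRHS]mulr1 ler_wpM2l//.
    by have /andP[a b] := cutoff_bound Z n (f x); rewrite ger0_norm.
have L2 : inner_L2 psi (eta n) @[n --> \oo] --> inner_L2 f psi.
  apply: (@Rintegral_dominated _ S _ _ (fun x => `|f x * psi x|)).
  - by move=> n; apply: measurable_funM => //; exact: continuous_measurable_fun.
  - exact: measurable_funM.
  - exact/integrable_norm/Lfun2_integrableM.
  - move=> x xS; rewrite mulrC; apply: cvgM; first exact: cvg_cst.
    exact: flatten_cvg.
  - move=> n x; rewrite !normrM mulrC ler_wpM2r//; exact: norm_flatten_le.
apply: oppr_inj; rewrite opprK; apply/esym.
apply: (@cvg_unique _ (@Rhausdorff R) _ _ _ _ L1).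
rewrite (_ : (fun n => _) = fun n => - inner_L2 psi (eta n)); last exact/funext.
exact: cvgN.
Qed.

Lemma C1c_bounded phi : is_C1c phi ->
  exists2 N, 0 < N & forall x, N <= `|x| -> phi x = 0 /\ derive1 phi x = 0.
Proof.
move=> [dphi cphi /compact_bounded[M [_ /(_ (`|M| + 1))]]].
move=> /(_ (le_lt_trans (ler_norm M) (ltr_pwDr ltr01 (lexx _)))) H.
have z x : `|M| + 1 < `|x| -> phi x = 0.
  move=> Mx; apply/eqP/negPn/negP => px.
  have : `|x| <= `|M| + 1 by apply: H; exact: subset_closure.
  by rewrite leNgt Mx.
exists (`|M| + 2); first by have := normr_ge0 M; lra.
move=> x Mx; have Mx1 : `|M| + 1 < `|x| by lra.
split; first exact: z.
have : is_derive x 1 phi 0.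
  apply: (near_eq_is_derive (f := cst 0)).
  have : `|y| @[y --> x] --> `|x| by apply: cvg_norm; exact: cvg_id.
  by move/cvgr_gt => /(_ _ Mx1); apply: filterS => y /z ->.
by move=> [_ <-]; rewrite derive1E.
Qed.

Lemma continuous_compact_support_Lfun2 phi N : continuous phi ->
  (forall x, N <= `|x| -> phi x = 0) -> phi \in Lfun mu 2%:E.
Proof.
move=> cphi H; apply: Lfun2P; first exact: continuous_measurable_fun.
have -> : EFin \o (fun x => phi x ^+ 2) =
    (EFin \o (fun x => phi x ^+ 2)) \_ `[-N, N].
  apply/funext => x; rewrite patchE; case: ifPn => //.
  rewrite notin_setE/= in_itv/= -ler_norml => /negP; rewrite -ltNge => /ltW/H /= ->.
  by rewrite expr0n.
apply/(integrable_mkcond _ _).1 => //.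
apply: (@continuous_integrable_itv R (fun x => phi x ^+ 2)) => x.
exact: (@continuous_comp _ _ _ phi (fun y : R => y ^+ 2) x (cphi x) (@exprn_continuous R 2 _)).
Qed.

(** Classical integration by parts on an interval containing the support. It lets a test function be
    the H^1 partner in [weak_by_parts]. *)
Lemma C1c_H1 phi : is_C1c phi -> H1_with phi (derive1 phi).
Proof.
move=> hphi; have [N N0 HN] := C1c_bounded hphi.
have [dphi cdphi _] := hphi.
have cphi : continuous phi.
  by move=> x; apply/differentiable_continuous/derivable1_diffP; exact: dphi.
split.
- by apply: (continuous_compact_support_Lfun2 (N := N)) => // x /HN[].
- by apply: (continuous_compact_support_Lfun2 (N := N)) => // x /HN[].
move=> eta heta; have [deta cdeta _] := heta.
have ceta : continuous eta.
  by move=> x; apply/differentiable_continuous/derivable1_diffP; exact: deta.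
have NN : - N < N by lra.
have red f g : (forall x, N <= `|x| -> f x = 0) ->
    inner_L2 f g = \int[mu]_(x in `[- N, N]) (f x * g x).
  move=> f0; rewrite /inner_L2 [RHS]Rintegral_mkcond.
  apply: eq_Rintegral => x _; rewrite patchE; case: ifPn => //.
  rewrite notin_setE/= in_itv/= -ler_norml => /negP; rewrite -ltNge => /ltW/f0 ->.
  by rewrite mul0r.
rewrite (red phi) ?(red (derive1 phi)); last 2 first.
  by move=> x /HN[].
  by move=> x /HN[].
have LR (h : R -> R) : (forall x, derivable h x 1) -> derivable_oo_LRcontinuous h (- N) N.
  move=> dh; have ch : continuous h.
    by move=> x; apply/differentiable_continuous/derivable1_diffP; exact: dh.
  split; first by move=> x _.
    by apply: cvg_at_right_filter; exact: ch.
  by apply: cvg_at_left_filter; exact: ch.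
have -> := @Rintegration_by_parts R phi eta (derive1 phi) (derive1 eta) _ _ NN
  (continuous_subspaceT cdphi) (LR _ dphi) (fun _ _ => erefl)
  (continuous_subspaceT cdeta) (LR _ deta) (fun _ _ => erefl).
by rewrite (HN N _).1 ?(HN (- N) _).1 ?normrN ?ler_norm// !mul0r subrr sub0r.
Qed.

Lemma H1_with_off S f g :
  continuous f -> vanishes_at_infinity f ->
  (forall x, x \notin S -> is_derive x 1 f (g x)) ->
  (forall x, x \notin S -> {for x, continuous g}) ->
  (forall x, x \notin S -> f x \notin 0 :: map f S) ->
  f \in Lfun mu 2%:E -> g \in Lfun mu 2%:E -> H1_with f g.
Proof.
move=> cf f0 df cg fS Lf Lg; split=> // phi /C1c_H1[Lphi Ldphi wphi].
exact: (@weak_by_parts S).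
Qed.

End WeakDerivative.

(** * Change of variables along an increasing curve *)

Section Range.
Variable R : realType.
Implicit Types (F E e W H : R -> R) (C d r : R).

Definition bounded_range E := exists C, forall r, `|E r| <= C.

(** For a bounded nondecreasing function, [hi] and [lo] are the limits at +oo and -oo. As supremum
    and infimum they inherit uniform estimates without a limit argument. *)
Definition hi E := sup (range E).
Definition lo E := inf (range E).

Lemma le_hi E r : bounded_range E -> E r <= hi E.
Proof.
move=> [C HC]; apply: ub_le_sup; last by exists r.
by exists C => _ [s _ <-]; exact: le_trans (ler_norm _) (HC s).
Qed.

Lemma ge_lo E r : bounded_range E -> lo E <= E r.
Proof.
move=> [C HC]; apply: ge_inf; last by exists r.
by exists (- C) => _ [s _ <-]; have := HC s; rewrite ler_norml => /andP[].
Qed.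

Lemma hi_le E C : (forall r, E r <= C) -> hi E <= C.
Proof. by move=> H; apply: ge_sup; [exists (E 0), 0|move=> _ [s _ <-]]. Qed.

Lemma lo_ge E C : (forall r, C <= E r) -> C <= lo E.
Proof. by move=> H; apply: lb_le_inf; [exists (E 0), 0|move=> _ [s _ <-]]. Qed.

Lemma hi_gt E x : x < hi E -> exists r, x < E r.
Proof.
by move=> /sup_gt[|_ [s _ <-] xs]; [exists (E 0), 0|exists s].
Qed.

Lemma lo_lt E x : lo E < x -> exists r, E r < x.
Proof.
by move=> /inf_lt[|_ [s _ <-] xs]; [exists (E 0), 0|exists s].
Qed.

Lemma hi_close E1 E2 d : bounded_range E1 -> bounded_range E2 ->
  (forall r, `|E1 r - E2 r| <= d) -> `|hi E1 - hi E2| <= d.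
Proof.
move=> b1 b2 H; rewrite ler_distl; apply/andP; split.
  rewrite lerBlDr; apply: hi_le => r.
  by have := H r; rewrite ler_distl => /andP[h _]; have := le_hi r b1; lra.
apply: hi_le => r.
by have := H r; rewrite ler_distl => /andP[_ h]; have := le_hi r b2; lra.
Qed.

Lemma lo_close E1 E2 d : bounded_range E1 -> bounded_range E2 ->
  (forall r, `|E1 r - E2 r| <= d) -> `|lo E1 - lo E2| <= d.
Proof.
move=> b1 b2 H; rewrite ler_distl; apply/andP; split.
  apply: lo_ge => r.
  by have := H r; rewrite ler_distl => /andP[h _]; have := ge_lo r b2; lra.
rewrite -lerBlDr; apply: lo_ge => r.
by have := H r; rewrite ler_distl => /andP[_ h]; have := ge_lo r b1; lra.
Qed.

(** [H] is a bounded primitive of the weight [W]: increments of [E] are at most C times those of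
    [H], and 4 is the length of [-2, 2]. This serves to bound one area uniformly in r, and also the
    difference of two areas. *)
Lemma dominated_derive E e H W C r : (forall s : R, is_derive s 1 E (e s)) ->
  (forall s : R, is_derive s 1 H (W s)) -> (forall s, `|H s| <= 2) -> 0 <= C ->
  (forall s, `|e s| <= C * W s) -> E 0 = 0 -> `|E r| <= 4 * C.
Proof.
move=> dE dH H2 C0 eW E0.
have dCH (s : R) : is_derive s 1 (fun y => C * H y) (C * W s) by exact: is_deriveZp.
have dNE (s : R) : is_derive s 1 (fun y => - E y) (- e s) by exact: is_deriveN.
have key a b : a <= b -> `|E b - E a| <= 4 * C.
  move=> ab.
  have h1 := @ler_incr_derive R E (fun y => C * H y) e _ a b ab
    (fun s _ => dE s) (fun s _ => dCH s)
    (fun s _ => le_trans (ler_norm _) (eW s)).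
  have h2 := @ler_incr_derive R (fun y => - E y) (fun y => C * H y) _ _ a b ab
    (fun s _ => dNE s) (fun s _ => dCH s).
  have {}h2 : - E b - - E a <= C * H b - C * H a.
    by apply: h2 => s _; apply: le_trans (eW s); rewrite -normrN ler_norm.
  have : C * H b - C * H a <= 4 * C.
    have := H2 a; have := H2 b; rewrite !ler_norml => /andP[b1 b2] /andP[a1 a2].
    by rewrite -mulrBr mulrC ler_wpM2r//; lra.
  rewrite ler_norml; lra.
have [r0|r0] := leP 0 r.
  by have := key _ _ r0; rewrite E0 subr0.
by have := key _ _ (ltW r0); rewrite E0 sub0r normrN.
Qed.

End Range.

(** * Inverse of an increasing curve and integration over its range *)

Section InverseFunction.
Variable R : realType.
Notation mu := (@lebesgue_measure R).
Variables (F rho : R -> R).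
Hypothesis dF : forall r : R, is_derive r 1 F (rho r).
Hypothesis rho_gt0 : forall r, 0 < rho r.

Definition inverse (f : R -> R) (y : R) : R := xget 0 [set r | f r = y].

(** The open interval between infimum and supremum, in a form that also makes sense for unbounded
    curves. *)
Definition open_range (f : R -> R) : set R := [set y | exists a b, f a < y < f b].

Lemma curve_lt : {homo F : a b / a < b}.
Proof. by move=> a b ab; exact: (ltr_incr_derive ab (fun r _ => dF r) (fun r _ => rho_gt0 r)). Qed.

Lemma curve_lt_mono : {mono F : a b / a < b}.
Proof.
move=> a b; apply/idP/idP; last exact: curve_lt.
apply: contraTT; rewrite -!leNgt le_eqVlt => /predU1P[->|/curve_lt/ltW]//.
Qed.

Lemma curve_inj : injective F.
Proof.
move=> a b; apply: contraPP => /eqP; rewrite neq_lt => /orP[] /curve_lt;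
  rewrite lt_neqAle => /andP[/eqP + _]; by [|move=> + /esym].
Qed.

Lemma curve_continuous : continuous F.
Proof. by move=> x; exact: is_derive_continuous (dF x). Qed.

Lemma inverseK r : inverse F (F r) = r.
Proof.
rewrite /inverse; case: xgetP => [s _ /= /curve_inj//|/(_ r)]; by case.
Qed.

Lemma inverse_range a b y : F a < y < F b ->
  [/\ F (inverse F y) = y, a < inverse F y & inverse F y < b].
Proof.
move=> /andP[ay yb].
have ab : a < b by rewrite -curve_lt_mono (lt_trans ay).
have [||c _ Fc] := @IVT R F a b y (ltW ab).
- exact/continuous_subspaceT/curve_continuous.
- by rewrite ge_min (ltW ay) le_max (ltW yb) orbT.
by rewrite -Fc inverseK; split; rewrite // -curve_lt_mono Fc.
Qed.

Lemma open_range_inverse y : open_range F y -> F (inverse F y) = y.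
Proof. by move=> [a [b /inverse_range[]]]. Qed.

Lemma open_rangeF r : open_range F (F r).
Proof. by exists (r - 1), (r + 1); rewrite !curve_lt_mono; apply/andP; split; lra. Qed.

Lemma is_derive_inverseF y : open_range F y ->
  is_derive y 1 (inverse F) (rho (inverse F y))^-1.
Proof.
move=> /open_range_inverse Fy; rewrite -{1}Fy; apply: is_derive_inverse.
- by near=> r; exact: inverseK.
- by near=> r; exact: curve_continuous.
- by rewrite gt_eqF.
Unshelve. all: by end_near. Qed.

Lemma is_derive_along (G g : R -> R) y : open_range F y ->
  (forall r : R, is_derive r 1 G (g r)) ->
  is_derive y 1 (G \o inverse F) (g (inverse F y) / rho (inverse F y)).
Proof. by move=> yF dG; apply: is_derive_comp; exact: is_derive_inverseF. Qed.

Lemma open_range_open : open (open_range F).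
Proof.
have -> : open_range F = \bigcup_(ab in [set: R * R]) [set` `]F ab.1, F ab.2[].
  apply/seteqP; split => [y [a [b ab]]|y [[a b] _]]; rewrite ?/= ?in_itv/=.
    by exists (a, b) => //=; rewrite in_itv.
  by move=> ab; exists a, b.
by apply: bigcup_open => ab _; exact: interval_open.
Qed.

Lemma open_rangeE : open_range F = \bigcup_n [set` `[F (- n%:R), F n%:R]].
Proof.
apply/seteqP; split => [y [a [b /andP[ay yb]]]|y [n _]]; last first.
  rewrite /= in_itv/= => /andP[ny yn]; exists (- n%:R - 1), (n%:R + 1).
  rewrite (lt_le_trans _ ny) ?(le_lt_trans yn)// curve_lt_mono; lra.
exists (Num.truncn (`|a| + `|b|)).+1 => //; rewrite /= in_itv/=.
set n := _.+1; have hn : `|a| + `|b| < n%:R by exact: truncnS_gt.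
have na : - n%:R < a.
  have := ler_norm (- a); rewrite normrN; have := normr_ge0 b; lra.
have bn : b < n%:R by have := ler_norm b; have := normr_ge0 a; lra.
by rewrite (ltW (lt_trans _ ay)) ?curve_lt_mono// (ltW (lt_trans yb _))// curve_lt_mono.
Qed.

Variables (h E : R -> R).
Hypothesis ch : continuous h.
Hypothesis h_ge0 : forall r, 0 <= h r.
Hypothesis dE : forall r : R, is_derive r 1 E (h r * rho r).
Hypothesis bE : bounded_range E.

Lemma along_ndecr : {homo E : a b / a <= b}.
Proof.
move=> a b ab; apply: (@ger0_derive_le R E _ a b ab (fun r _ => dE r)) => r _.
by rewrite mulr_ge0// ltW.
Qed.

Lemma along_increments_cvg : (E n%:R - E (- n%:R))%:E @[n --> \oo] --> (hi E - lo E)%:E.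
Proof.
apply: cvg_EFin; first exact: nearW.
apply/cvgrPdist_le => e e0.
have [a Ea] : exists r, hi E - e / 2 < E r by apply: hi_gt; rewrite ltrBlDr ltrDl divr_gt0.
have [b Eb] : exists r, E r < lo E + e / 2 by apply: lo_lt; rewrite ltrDl divr_gt0.
near=> n.
have an : E a <= E n%:R.
  by apply: along_ndecr; near: n; exact: nbhs_infty_ger.
have bn : E (- n%:R) <= E b.
  by apply: along_ndecr; rewrite lerNl; near: n; exact: nbhs_infty_ger.
have := le_hi n%:R bE; have := ge_lo (- n%:R) bE.
rewrite /= ler_distl; lra.
Unshelve. all: by end_near. Qed.

Let is_derive_E_inverse y : open_range F y -> is_derive y 1 (E \o inverse F) (h (inverse F y)).
Proof.
by move=> /is_derive_along/(_ dE); rewrite mulfK// gt_eqF.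
Qed.

Let in_open_range n y : F (- n%:R) <= y <= F n%:R -> open_range F y.
Proof. by move=> yn; rewrite open_rangeE; exists n => //=; rewrite in_itv. Qed.

Let continuous_h_inverse y : open_range F y -> {for y, continuous (h \o inverse F)}.
Proof.
move=> yF; apply: continuous_comp; last exact: ch.
exact: is_derive_continuous (is_derive_inverseF yF).
Qed.

Lemma measurable_along : measurable_fun (open_range F) (h \o inverse F).
Proof.
apply: open_continuous_measurable_fun; first exact: open_range_open.
by move=> y /set_mem; exact: continuous_h_inverse.
Qed.

(** [E] composed with the inverse of [F] is a primitive of the integrand, so the integral over
    [F(-n), F(n)] is E(n) - E(-n); monotone convergence exhausts the range. *)
Lemma integral_along :
  (\int[mu]_(y in open_range F) (h (inverse F y))%:E = (hi E - lo E)%:E)%E.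
Proof.
have H : (\int[mu]_(y in `[F (- n%:R), F n%:R]) (h (inverse F y))%:E)%E @[n --> \oo]
    --> (\int[mu]_(y in open_range F) (h (inverse F y))%:E)%E.
  rewrite open_rangeE; apply: ge0_nondecreasing_set_cvg_integral.
  - move=> m n mn; apply/subsetPset => y; rewrite /= !in_itv/= => /andP[my ym].
    have mn' : m%:R <= n%:R :> R by rewrite ler_nat.
    by rewrite (le_trans _ my) ?(le_trans ym)// leNgt curve_lt_mono -leNgt// lerN2.
  - by move=> n; exact: measurable_itv.
  - move=> n; apply/measurable_EFinP; apply: measurable_funS measurable_along.
      by apply: open_measurable; exact: open_range_open.
    by move=> y; rewrite /= in_itv/=; exact: in_open_range.
  - by move=> n y _; rewrite lee_fin.
apply: (@cvg_unique _ (@ereal_hausdorff R) _ _ _ _ H).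
rewrite (_ : (fun n : nat => _) = fun n : nat => (E n%:R - E (- n%:R))%:E).
  exact: along_increments_cvg.
(* The fundamental theorem of calculus asks for a nondegenerate interval, so n = 0 is a case
   apart. *)
apply/funext => -[|n].
  by rewrite oppr0 set_itv1 integral_set1 subrr.
have nn : - n.+1%:R < n.+1%:R :> R by rewrite -subr_gt0 opprK -natrD ltr0n.
rewrite (@continuous_FTC2 R (h \o inverse F) (E \o inverse F)).
- by rewrite /= !inverseK.
- by rewrite curve_lt_mono.
- apply: continuous_in_subspaceT => y; rewrite inE/= in_itv/= => yn.
  exact: continuous_h_inverse (in_open_range yn).
- split.
  + move=> y; rewrite in_itv/= => /andP[ny yn].
    apply: (ex_derive (is_derive := is_derive_E_inverse _)).
    by apply: (@in_open_range n.+1); rewrite !ltW.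
  + apply: cvg_at_right_filter.
    exact: is_derive_continuous (is_derive_E_inverse (open_rangeF _)).
  + apply: cvg_at_left_filter.
    exact: is_derive_continuous (is_derive_E_inverse (open_rangeF _)).
- move=> y; rewrite in_itv/= => /andP[ny yn].
  rewrite derive1E; apply: derive_val.
  by apply: is_derive_E_inverse; apply: (@in_open_range n.+1); rewrite !ltW.
Qed.

End InverseFunction.

(** * Mirror images of curves, for the left half-line *)

Section Reflection.
Variable R : realType.
Notation mu := (@lebesgue_measure R).
Implicit Types (F E h : R -> R).

(** Half-turn of the graph: again an increasing curve, running through the mirror image of the range
    with speed rho(-r), so the results on increasing curves apply to it. *)
Definition reflect_fun F (r : R) := - F (- r).

Lemma is_derive_opp_arg F (d r : R) : is_derive (- r) 1 F d ->
  is_derive r 1 (fun s => F (- s)) (- d).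
Proof.
by move=> dF; rewrite -mulrN1; apply: is_derive_comp.
Qed.

Lemma is_derive_reflect F (f : R -> R) : (forall r : R, is_derive r 1 F (f r)) ->
  forall r : R, is_derive r 1 (reflect_fun F) (f (- r)).
Proof.
move=> dF r; rewrite -[f _]opprK.
exact: (is_deriveN (is_derive_opp_arg (dF (- r)))).
Qed.

Lemma bounded_range_reflect E : bounded_range E -> bounded_range (reflect_fun E).
Proof. by move=> [C HC]; exists C => r; rewrite normrN. Qed.

Lemma hi_lo_reflect E : bounded_range E ->
  hi (reflect_fun E) - lo (reflect_fun E) = hi E - lo E.
Proof.
move=> bE; have bN := bounded_range_reflect bE.
suff [-> ->] : hi (reflect_fun E) = - lo E /\ lo (reflect_fun E) = - hi E.
  by lra.
split; apply/eqP; rewrite eq_le; apply/andP; split.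
- by apply: hi_le => r; rewrite lerN2; exact: ge_lo.
- rewrite lerNl; apply: lo_ge => r; rewrite lerNl.
  by have := le_hi (- r) bN; rewrite /reflect_fun opprK.
- rewrite lerNr; apply: hi_le => r; rewrite lerNr.
  by have := ge_lo (- r) bN; rewrite /reflect_fun opprK.
- by apply: lo_ge => r; rewrite lerN2; exact: le_hi.
Qed.

Lemma open_range_reflect F y : open_range (reflect_fun F) y <-> open_range F (- y).
Proof.
split=> -[a [b /andP[ay yb]]]; exists (- b), (- a).
  by rewrite ltrNr ltrNl; apply/andP; split; rewrite // -/(reflect_fun F _).
by rewrite /reflect_fun !opprK ltrNl ltrNr yb.
Qed.

Lemma inverse_reflect F (rho : R -> R) y : (forall r : R, is_derive r 1 F (rho r)) ->
  (forall r, 0 < rho r) -> open_range F (- y) ->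
  inverse (reflect_fun F) y = - inverse F (- y).
Proof.
move=> dF rho0 yF; rewrite -[in LHS](opprK y) -{1}(open_range_inverse dF rho0 yF).
rewrite -[inverse F (- y) in LHS]opprK.
exact: (inverseK (is_derive_reflect dF) (fun r => rho0 (- r))).
Qed.

Lemma integral_along_reflect F (rho : R -> R) h E :
  (forall r : R, is_derive r 1 F (rho r)) -> (forall r, 0 < rho r) ->
  continuous h -> (forall r, 0 <= h r) ->
  (forall r : R, is_derive r 1 E (h r * rho r)) -> bounded_range E ->
  (\int[mu]_(y in [set y | open_range F (- y)%R]) (h (inverse F (- y)%R))%:E
    = (hi E - lo E)%:E)%E.
Proof.
move=> dF rho0 ch h0 dE bE; rewrite -(hi_lo_reflect bE).
have ch' : continuous (fun r => h (- r)).
  move=> r; apply: continuous_comp; last exact: ch.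
  exact: opp_continuous.
rewrite -(integral_along (is_derive_reflect dF) (fun r => rho0 (- r)) ch'
  (fun r => h0 (- r)) (is_derive_reflect dE) (bounded_range_reflect bE)).
have -> : [set y | open_range F (- y)] = open_range (reflect_fun F).
  by apply/seteqP; split => y /open_range_reflect.
apply: eq_integral => y /set_mem/open_range_reflect yF.
by rewrite (inverse_reflect dF rho0 yF) opprK.
Qed.

End Reflection.

(** * Solutions of amplitude A as curves *)

Section Segment.
Variable R : realType.
Variable k : R.
Hypothesis k_gt0 : 0 < k.
Implicit Types (A sigma q r : R).

Definition gauss q : R := expR (- q ^+ 2).
(** By the first integral, m u as a function of the slope parameter q. *)
Definition height A q : R := Num.sqrt (1 + A * gauss q).
Definition steep sigma r : R := expR (sigma * r).

(* With slope parameter q = e^(sigma r), the curve of amplitude A traverses the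
   graph with speed dx/dr = density: sigma A > 0 makes x increase with r. *)
Definition density A sigma r : R :=
  sigma * A * gauss (steep sigma r) * steep sigma r
  / (k * height A (steep sigma r)).

Lemma gauss_gt0 q : 0 < gauss q. Proof. exact: expR_gt0. Qed.

Lemma gauss_le1 q : gauss q <= 1.
Proof. by rewrite /gauss expR_le1 oppr_le0 sqr_ge0. Qed.

Lemma gauss_lt1 q : q != 0 -> gauss q < 1.
Proof. by move=> q0; rewrite /gauss expR_lt1 oppr_lt0 exprn_even_gt0. Qed.

(** 256 = 4^4: raise 1 + y <= 4 exp(y/4), with y = q^2, to the fourth power. One of the four factors
    is spent on the weight q / (1 + q^2), three are left for the integrands. *)
Lemma gauss_decay q : gauss q * (1 + q ^+ 2) ^+ 4 <= 256.
Proof.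
rewrite /gauss expRN mulrC ler_pdivrMr ?expR_gt0//.
have q0 : 0 <= q ^+ 2 by exact: sqr_ge0.
have h : 1 + q ^+ 2 <= 4 * expR (q ^+ 2 / 4).
  by have := expR_ge1Dx (q ^+ 2 / 4); lra.
have -> : expR (q ^+ 2) = expR (q ^+ 2 / 4) ^+ 4.
  by rewrite -expRM_natl; congr expR; lra.
apply: (@le_trans _ _ ((4 * expR (q ^+ 2 / 4)) ^+ 4)).
  by rewrite ler_pXn2r ?nnegrE// ?mulr_ge0 ?expR_ge0//; lra.
by rewrite exprMn -natrX.
Qed.

Lemma gauss_le q : gauss q <= (1 + q ^+ 2)^-1.
Proof.
have q0 : 0 <= q ^+ 2 by exact: sqr_ge0.
rewrite /gauss expRN lef_pV2 ?posrE ?expR_gt0//; last by lra.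
exact: expR_ge1Dx.
Qed.

Lemma steep_gt0 sigma r : 0 < steep sigma r. Proof. exact: expR_gt0. Qed.

Lemma is_derive_steep sigma r :
  is_derive r 1 (steep sigma) (sigma * steep sigma r).
Proof.
rewrite mulrC; apply: (@is_derive_comp R expR (fun r => sigma * r)).
by rewrite -[X in is_derive _ _ _ X]mulr1; apply: is_deriveZp.
Qed.

Lemma is_derive_gauss q : is_derive q 1 gauss (- (2 * q) * gauss q).
Proof.
rewrite mulrC; apply: (@is_derive_comp R expR (fun q => - q ^+ 2)).
apply: is_deriveN; rewrite (_ : 2 * q = 1 * q + q * 1); last by ring.
by apply: (@is_deriveMp R id id).
Qed.

Lemma continuous_gauss : continuous gauss.
Proof. by move=> q; exact: is_derive_continuous (is_derive_gauss q). Qed.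

Lemma is_derive_gauss_steep sigma r :
  is_derive r 1 (fun r => gauss (steep sigma r))
    (- (2 * sigma * steep sigma r ^+ 2) * gauss (steep sigma r)).
Proof.
rewrite (_ : _ * gauss _ = - (2 * steep sigma r) * gauss (steep sigma r)
  * (sigma * steep sigma r)); last by ring.
exact: (is_derive_comp (is_derive_gauss _) (is_derive_steep _ _)).
Qed.

(** [-1 <= A] makes the radicand of the height positive for q nonzero. The pairs in use are (A, 1)
    with A > 0 for the crest and (-1, -1) for the tail. *)
Definition admissible A sigma := [/\ sigma ^+ 2 = 1, 0 < sigma * A & -1 <= A].

Lemma height2_gt0 A q : -1 <= A -> q != 0 -> 0 < 1 + A * gauss q.
Proof. by move=> A1 /gauss_lt1; have := gauss_gt0 q; nra. Qed.

Lemma height_gt0 A q : -1 <= A -> q != 0 -> 0 < height A q.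
Proof. by move=> A1 q0; rewrite sqrtr_gt0 height2_gt0. Qed.

Lemma sqr_height A q : -1 <= A -> height A q ^+ 2 = 1 + A * gauss q.
Proof.
by move=> A1; rewrite sqr_sqrtr//; have := gauss_gt0 q; have := gauss_le1 q; nra.
Qed.

Lemma is_derive_height A sigma r : -1 <= A ->
  is_derive r 1 (fun r => height A (steep sigma r))
    (- (sigma * A * steep sigma r ^+ 2 * gauss (steep sigma r))
       / height A (steep sigma r)).
Proof.
move=> A1; have q0 : steep sigma r != 0 by rewrite gt_eqF// steep_gt0.
have h0 := height2_gt0 A1 q0.
have d := @is_derive_comp R Num.sqrt (fun r => 1 + A * gauss (steep sigma r)) r _ _
  (is_derive1_sqrt h0)
  (is_deriveDp (is_derive_cstp 1 r) (is_deriveZp A (is_derive_gauss_steep sigma r))).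
apply: (is_derive_eq d); rewrite /height.
have : Num.sqrt (1 + A * gauss (steep sigma r)) != 0 by rewrite gt_eqF// sqrtr_gt0.
by move=> h; field; rewrite h.
Qed.

Lemma density_gt0 A sigma r : admissible A sigma -> 0 < density A sigma r.
Proof.
case=> s2 sA A1; have q0 := steep_gt0 sigma r.
apply: divr_gt0; last by rewrite mulr_gt0// height_gt0// gt_eqF.
by apply: mulr_gt0 => //; apply: mulr_gt0 => //; exact: gauss_gt0.
Qed.

Lemma continuous_gauss_steep sigma : continuous (fun r => gauss (steep sigma r)).
Proof. by move=> r; exact: is_derive_continuous (is_derive_gauss_steep sigma r). Qed.

Lemma continuous_steep sigma : continuous (steep sigma).
Proof. by move=> r; exact: is_derive_continuous (is_derive_steep sigma r). Qed.

Lemma continuous_density A sigma : -1 <= A -> continuous (density A sigma).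
Proof.
move=> A1 r; have q0 : steep sigma r != 0 by rewrite gt_eqF// steep_gt0.
apply: cvgM.
  apply: cvgM; last exact: continuous_steep.
  by apply: cvgM; [exact: cvg_cst|exact: continuous_gauss_steep].
apply: cvgV; first by rewrite mulf_neq0 ?gt_eqF// height_gt0.
apply: cvgM; first exact: cvg_cst.
exact: is_derive_continuous (is_derive_height sigma r A1).
Qed.

(** The quotient of d(height)/dr by dx/dr: this is m u' = - k q, which identifies q as the rescaled
    slope. *)
Lemma height_density A sigma r : admissible A sigma ->
  - (sigma * A * steep sigma r ^+ 2 * gauss (steep sigma r))
       / height A (steep sigma r) / density A sigma r = - (k * steep sigma r).
Proof.
move=> [s2 sA A1]; have q0 : steep sigma r != 0 by rewrite gt_eqF// steep_gt0.
have h0 := height_gt0 A1 q0.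
have [sigma0 A0] : sigma != 0 /\ A != 0.
  by apply/andP; rewrite -negb_or -mulf_eq0 gt_eqF.
have g0 : gauss (steep sigma r) != 0 by rewrite gt_eqF// gauss_gt0.
rewrite /density; field.
by rewrite sigma0 A0 q0 g0 !gt_eqF.
Qed.

Lemma is_derive_flux A sigma r :
  is_derive r 1 (fun r => A * gauss (steep sigma r) * steep sigma r)
   (sigma * A * gauss (steep sigma r) * steep sigma r * (1 - 2 * steep sigma r ^+ 2)).
Proof.
apply: (is_derive_eq (is_deriveMp (is_deriveZp A (is_derive_gauss_steep sigma r))
  (is_derive_steep sigma r))).
by ring.
Qed.

(** The differential equation along the curve. After multiplication by k/m, the left side is the
    x-derivative of the flux (k/m) A exp(-q^2) q, and the right side is k^2 u (1 - 2 q^2) = k^2 u -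
    2 m^2 u u'^2. *)
Lemma flux_density A sigma r : admissible A sigma ->
  sigma * A * gauss (steep sigma r) * steep sigma r * (1 - 2 * steep sigma r ^+ 2)
  / density A sigma r
  = k * height A (steep sigma r) * (1 - 2 * steep sigma r ^+ 2).
Proof.
move=> [s2 sA A1]; have q0 : steep sigma r != 0 by rewrite gt_eqF// steep_gt0.
have h0 := height_gt0 A1 q0.
have [sigma0 A0] : sigma != 0 /\ A != 0.
  by apply/andP; rewrite -negb_or -mulf_eq0 gt_eqF.
have g0 : gauss (steep sigma r) != 0 by rewrite gt_eqF// gauss_gt0.
rewrite /density; field.
by rewrite sigma0 A0 q0 g0 !gt_eqF.
Qed.

(** |dq| / (1 + q^2) written in the parameter r, hence the bounded primitive sigma atan q. *)
Definition weight sigma r : R := steep sigma r / (1 + steep sigma r ^+ 2).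
Definition weight_primitive sigma r : R := sigma * atan (steep sigma r).

Lemma is_derive_weight_primitive sigma r : sigma ^+ 2 = 1 ->
  is_derive r 1 (weight_primitive sigma) (weight sigma r).
Proof.
move=> s2.
have d := is_deriveZp sigma (@is_derive_comp R atan (steep sigma) r _ _
  (is_derive1_atan _) (is_derive_steep sigma r)).
apply: (is_derive_eq d).
rewrite mulrCA [sigma * (_ * _)]mulrA -expr2 s2 mul1r /weight mulrC//.
Qed.

Lemma weight_primitive_le2 sigma r : sigma ^+ 2 = 1 ->
  `|weight_primitive sigma r| <= 2.
Proof.
move=> s2; have s1 : `|sigma| = 1.
  by apply/eqP; rewrite -(@eqrXn2 _ 2)// ?normr_ge0// real_normK ?num_real// s2 expr1n.
rewrite normrM s1 mul1r ler_norml.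
have := @pihalf_lt2 R; have := atan_ltpi2 (steep sigma r).
have := atan_gtNpi2 (steep sigma r); lra.
Qed.

Lemma gauss_weight sigma r :
  gauss (steep sigma r) * steep sigma r * (1 + steep sigma r ^+ 2) ^+ 3
  <= 256 * weight sigma r.
Proof.
rewrite /weight; set q := steep sigma r.
have q0 : 0 < q := steep_gt0 sigma r.
have D : 0 < 1 + q ^+ 2 by have := sqr_ge0 q; lra.
rewrite mulrA ler_pdivlMr//.
have -> : gauss q * q * (1 + q ^+ 2) ^+ 3 * (1 + q ^+ 2)
  = gauss q * (1 + q ^+ 2) ^+ 4 * q by ring.
by rewrite ler_wpM2r ?(ltW q0)// gauss_decay.
Qed.

Lemma bump_density_le A r : 0 < A ->
  density A 1 r <= A / k * (gauss (steep 1 r) * steep 1 r).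
Proof.
move=> A0; rewrite /density mul1r.
have q0 : steep 1 r != 0 by rewrite gt_eqF// steep_gt0.
have A1 : -1 <= A by lra.
have h1 : 1 <= height A (steep 1 r).
  by rewrite /height -[leLHS]sqrtr1 ler_wsqrtr// lerDl mulr_ge0 ?ltW// gauss_gt0.
have h0 : height A (steep 1 r) != 0 by rewrite gt_eqF//; lra.
rewrite ler_pdivrMr; last by rewrite mulr_gt0//; lra.
have -> : A / k * (gauss (steep 1 r) * steep 1 r) * (k * height A (steep 1 r))
  = A * gauss (steep 1 r) * steep 1 r * height A (steep 1 r).
  by field; rewrite gt_eqF.
have P0 : 0 < A * gauss (steep 1 r) * steep 1 r.
  by apply: mulr_gt0 (steep_gt0 _ _); apply: mulr_gt0 (gauss_gt0 _).
by apply: ler_peMr h1; exact: ltW.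
Qed.

Lemma tail_admissible : admissible (-1) (-1).
Proof. by split; [rewrite sqrrN expr1n|rewrite mulrNN mulr1|]. Qed.

Lemma bump_admissible A : 0 < A -> admissible A 1.
Proof. by move=> A0; split; [rewrite expr1n|rewrite mul1r|lra]. Qed.

(** The height sqrt(1 - exp(-q^2)) in the denominator vanishes with q; it is bounded below through 1
    - exp(-q^2) >= q^2/(1+q^2) >= (q/(1+q^2))^2. *)
Lemma tail_density_le r :
  density (-1) (-1) r <= gauss (steep (-1) r) * (1 + steep (-1) r ^+ 2) / k.
Proof.
have q0 := steep_gt0 (-1) r; rewrite /density; set q := steep (-1) r in q0 *.
have D : 0 < 1 + q ^+ 2 by have := sqr_ge0 q; lra.
have h0 : 0 < height (-1) q by rewrite height_gt0// gt_eqF.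
have qh : q / (1 + q ^+ 2) <= height (-1) q.
  rewrite -[leLHS]ger0_norm ?divr_ge0 ?(ltW q0) ?(ltW D)// -sqrtr_sqr ler_wsqrtr//.
  rewrite mulN1r; apply: (@le_trans _ _ (1 - (1 + q ^+ 2)^-1)); last first.
    by rewrite lerB// gauss_le.
  rewrite (_ : 1 - _ = q ^+ 2 / (1 + q ^+ 2)); last by field; rewrite gt_eqF.
  rewrite exprMn ler_wpM2l ?sqr_ge0// expr2 -[leRHS]mul1r ler_wpM2r ?invr_ge0 ?(ltW D)//.
  by rewrite invf_le1//; have := sqr_ge0 q; lra.
rewrite ler_pdivrMr ?mulr_gt0// mulrNN mulr1 mul1r.
have -> : gauss q * (1 + q ^+ 2) / k * (k * height (-1) q)
  = gauss q * (height (-1) q * (1 + q ^+ 2)) by field; rewrite gt_eqF.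
by rewrite ler_wpM2l ?(ltW (gauss_gt0 _))// -ler_pdivrMr.
Qed.

(** For r >= 0 one has q <= 1, hence height <= q and exp(-q^2) >= exp(-1). A speed bounded below
    carries the tail to x = +oo. *)
Lemma tail_density_ge r : 0 <= r -> expR (-1) / k <= density (-1) (-1) r.
Proof.
move=> r0; have q0 := steep_gt0 (-1) r; rewrite /density.
have q1 : steep (-1) r <= 1 by rewrite /steep expR_le1; lra.
set q := steep (-1) r in q0 q1 *.
have h0 : 0 < height (-1) q by rewrite height_gt0// gt_eqF.
have hq : height (-1) q <= q.
  rewrite -[leRHS]ger0_norm ?(ltW q0)// -sqrtr_sqr ler_wsqrtr// mulN1r.
  by have := expR_ge1Dx (- q ^+ 2); rewrite -/(gauss q); lra.
have g1 : expR (-1) <= gauss q by rewrite ler_expR lerN2 expr_le1// ltW.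
rewrite mulrNN mulr1 mul1r ler_pdivlMr ?mulr_gt0//.
have -> : expR (-1) / k * (k * height (-1) q) = expR (-1) * height (-1) q.
  by field; rewrite gt_eqF.
by rewrite ler_pM ?expR_ge0 ?(ltW h0).
Qed.

(** The primitive in r of h(q) dx along the curve. For h = 1 it is x itself, up to a constant. *)
Definition area A sigma (h : R -> R) : R -> R :=
  primitive (fun r => h (steep sigma r) * density A sigma r).

Lemma is_derive_area A sigma (h : R -> R) r : -1 <= A -> continuous h ->
  is_derive r 1 (area A sigma h) (h (steep sigma r) * density A sigma r).
Proof.
move=> A1 ch.
apply: (@is_derive_primitive R (fun r => h (steep sigma r) * density A sigma r)) => s.
apply: cvgM; last exact: continuous_density.
by apply: continuous_comp; [exact: continuous_steep|exact: ch].
Qed.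

Lemma bump_area_le A (h : R -> R) C r : 0 < A ->
  (forall q, 0 < q -> 0 <= h q <= C * (1 + q ^+ 2) ^+ 2) ->
  h (steep 1 r) * density A 1 r <= 256 * C * A / k * weight 1 r.
Proof.
move=> A0 hC; have q0 := steep_gt0 1 r; have := gauss_weight 1 r.
have := hC _ q0; have := bump_density_le r A0.
have g0 := gauss_gt0 (steep 1 r).
set q := steep 1 r in q0 g0 *; set d := density _ _ _; set w := weight _ _.
move=> dle /andP[h0 hle] gw.
have D : 1 <= 1 + q ^+ 2 by have := sqr_ge0 q; lra.
have C0 : 0 <= C.
  have := le_trans h0 hle; rewrite pmulr_lge0// exprn_gt0//; lra.
apply: (@le_trans _ _ (C * (1 + q ^+ 2) ^+ 2 * (A / k * (gauss q * q)))).
  by rewrite ler_pM// ltW// density_gt0//; exact: bump_admissible.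
have -> : C * (1 + q ^+ 2) ^+ 2 * (A / k * (gauss q * q))
  = C * A / k * (gauss q * q * (1 + q ^+ 2) ^+ 2) by ring.
have -> : 256 * C * A / k * w = C * A / k * (256 * w) by ring.
rewrite ler_wpM2l ?divr_ge0 ?mulr_ge0 ?(ltW A0) ?(ltW k_gt0)//.
apply: le_trans gw; rewrite ler_wpM2l ?mulr_ge0 ?(ltW g0) ?(ltW q0)//.
by rewrite [leRHS]exprS ler_peMl// exprn_ge0//; lra.
Qed.

(** The tail is infinitely long, so [h] has to vanish at q = 0, which the factor q^2 ensures. After
    the Gaussian decay is used, what remains is q <= 1 + q^2. *)
Lemma tail_area_le (h : R -> R) C r :
  (forall q, 0 < q -> 0 <= h q <= C * q ^+ 2 * (1 + q ^+ 2)) ->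
  h (steep (-1) r) * density (-1) (-1) r <= 256 * C / k * weight (-1) r.
Proof.
move=> hC; have q0 := steep_gt0 (-1) r; have := gauss_weight (-1) r.
have := hC _ q0; have := tail_density_le r.
have g0 := gauss_gt0 (steep (-1) r).
set q := steep (-1) r in q0 g0 *; set d := density _ _ _; set w := weight _ _.
move=> dle /andP[h0 hle] gw.
have D : 1 <= 1 + q ^+ 2 by have := sqr_ge0 q; lra.
have C0 : 0 <= C.
  have := le_trans h0 hle; rewrite -mulrA pmulr_lge0// mulr_gt0 ?exprn_gt0//; lra.
apply: (@le_trans _ _ (C * q ^+ 2 * (1 + q ^+ 2) * (gauss q * (1 + q ^+ 2) / k))).
  by rewrite ler_pM// ltW// density_gt0//; exact: tail_admissible.
have -> : C * q ^+ 2 * (1 + q ^+ 2) * (gauss q * (1 + q ^+ 2) / k)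
  = C / k * (gauss q * q * (1 + q ^+ 2) ^+ 2 * q) by ring.
have -> : 256 * C / k * w = C / k * (256 * w) by ring.
rewrite ler_wpM2l ?divr_ge0 ?(ltW k_gt0)//.
apply: le_trans gw; rewrite [(1 + q ^+ 2) ^+ 3]exprSr [leRHS]mulrA ler_wpM2l//.
  by rewrite !mulr_ge0 ?exprn_ge0 ?(ltW g0) ?(ltW q0)//; lra.
by have := sqr_ge0 (q - 1); nra.
Qed.

Lemma area0 A sigma h : area A sigma h 0 = 0.
Proof. exact: primitive0. Qed.

Lemma bump_area_bounded A (h : R -> R) C : 0 < A -> continuous h ->
  (forall q, 0 < q -> 0 <= h q <= C * (1 + q ^+ 2) ^+ 2) ->
  bounded_range (area A 1 h).
Proof.
move=> A0 ch hC; exists (4 * (256 * C * A / k)) => r.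
have [s2 sA A1] := bump_admissible A0.
have C0 : 0 <= C.
  have /andP[h0 h1] := hC 1 ltr01; move: (le_trans h0 h1).
  by rewrite pmulr_lge0// exprn_gt0// expr1n; lra.
apply: (@dominated_derive R (area A 1 h) _ _ _ (256 * C * A / k) r
  (fun s => is_derive_area 1 s A1 ch)
  (fun s => is_derive_weight_primitive s s2) (fun s => weight_primitive_le2 s s2)).
- by apply: divr_ge0 (ltW k_gt0); apply: mulr_ge0 (ltW A0); exact: mulr_ge0.
- move=> s; rewrite ger0_norm; first exact: bump_area_le.
  have /andP[h0 _] := hC _ (steep_gt0 1 s).
  by rewrite mulr_ge0// ltW// density_gt0//; exact: bump_admissible.
- exact: area0.
Qed.

Lemma tail_area_bounded (h : R -> R) C : continuous h ->
  (forall q, 0 < q -> 0 <= h q <= C * q ^+ 2 * (1 + q ^+ 2)) ->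
  bounded_range (area (-1) (-1) h).
Proof.
move=> ch hC; exists (4 * (256 * C / k)) => r.
have [s2 sA A1] := tail_admissible.
have C0 : 0 <= C.
  have /andP[h0 h1] := hC 1 ltr01; move: (le_trans h0 h1).
  by rewrite -mulrA pmulr_lge0// expr1n; lra.
apply: (@dominated_derive R (area (-1) (-1) h) _ _ _ (256 * C / k) r
  (fun s => is_derive_area (-1) s A1 ch)
  (fun s => is_derive_weight_primitive s s2) (fun s => weight_primitive_le2 s s2)).
- by apply: divr_ge0 (ltW k_gt0); exact: mulr_ge0.
- move=> s; rewrite ger0_norm; first exact: tail_area_le.
  have /andP[h0 _] := hC _ (steep_gt0 (-1) s).
  by rewrite mulr_ge0// ltW// density_gt0//; exact: tail_admissible.
- exact: area0.
Qed.

(** Here z is a value of [gauss] and sA, sB are the two heights. Positive amplitudes keep the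
    heights at least 1, away from the singularity of the square root, and (sA - sB)(sA + sB) = (A -
    B) z. *)
Lemma lipschitz_height A B z sA sB : 0 < A -> 0 < B -> 0 <= z <= 1 ->
  1 <= sA -> 1 <= sB -> sA ^+ 2 = 1 + A * z -> sB ^+ 2 = 1 + B * z ->
  `|sA - sB| <= `|A - B|.
Proof.
move=> A0 B0 /andP[z0 z1] sA1 sB1 sA2 sB2.
have E : (sA - sB) * (sA + sB) = (A - B) * z by ring: sA2 sB2.
apply: (@le_trans _ _ (`|sA - sB| * (sA + sB))).
  by rewrite ler_peMr//; lra.
rewrite -[sA + sB]ger0_norm; last by lra.
by rewrite -normrM E normrM [`|z|]ger0_norm// ler_piMr.
Qed.

(** A / height is the only factor of the crest density that depends on A. *)
Lemma lipschitz_div_height A B M z sA sB : 0 < A -> 0 < B -> A <= M -> B <= M -> 0 <= z <= 1 ->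
  1 <= sA -> 1 <= sB -> sA ^+ 2 = 1 + A * z -> sB ^+ 2 = 1 + B * z ->
  `|A / sA - B / sB| <= (1 + M) * `|A - B|.
Proof.
move=> A0 B0 AM BM z01 sA1 sB1 sA2 sB2.
have sAB := lipschitz_height A0 B0 z01 sA1 sB1 sA2 sB2; case/andP: z01 => z0 z1.
have -> : A / sA - B / sB = ((A - B) / sA) - B * ((sA - sB) / (sA * sB)).
  by field; rewrite !gt_eqF//; lra.
apply: (le_trans (ler_normB _ _)); rewrite [(1 + M) * _]mulrDl mul1r lerD//.
  rewrite normrM normfV [`|sA|]ger0_norm; last by lra.
  by rewrite ler_pdivrMr ?ler_peMr//; lra.
rewrite normrM [`|B|]ger0_norm ?(ltW B0)// ler_pM ?(ltW B0)//.
apply: le_trans sAB; rewrite normrM normfV.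
rewrite [X in _ / X]ger0_norm; last by rewrite mulr_ge0//; lra.
by rewrite ler_pdivrMr ?mulr_gt0 ?ler_peMr//; nra.
Qed.

(** The counterpart for the integral of u^2: height^2 times the density depends on A only through A
    height. *)
Lemma lipschitz_mul_height A B M z sA sB : 0 < A -> 0 < B -> A <= M -> B <= M -> 0 <= z <= 1 ->
  1 <= sA -> 1 <= sB -> sA ^+ 2 = 1 + A * z -> sB ^+ 2 = 1 + B * z ->
  `|A * sA - B * sB| <= (1 + 2 * M) * `|A - B|.
Proof.
move=> A0 B0 AM BM z01 sA1 sB1 sA2 sB2.
have sAB := lipschitz_height A0 B0 z01 sA1 sB1 sA2 sB2; case/andP: z01 => z0 z1.
have -> : A * sA - B * sB = (A - B) * sA + B * (sA - sB) by ring.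
have sAM : sA <= 1 + M.
  by apply: (@le_trans _ _ (sA ^+ 2)); [rewrite expr2 ler_peMr//; lra|rewrite sA2; nra].
have b0 := normr_ge0 (A - B).
apply: (le_trans (ler_normD _ _)); rewrite !normrM [`|sA|]ger0_norm; last by lra.
by rewrite [`|B|]ger0_norm ?(ltW B0)//; have := sAB; nra.
Qed.

End Segment.

(** * The profile on the half-line *)

Section Profile.
Variable R : realType.
Variable k : R.
Hypothesis k_gt0 : 0 < k.
Implicit Types (A q r x y : R).

Local Notation one := (fun _ : R => 1 : R).
Local Notation area := (area k).
Local Notation density := (density k).

(** Half the length of the crest, approached as q tends to infinity. The two curves below are the
    abscissa normalised to start at 0 and at [width A]; the tail is unbounded above, so only its
    infimum enters. *)
Definition width A : R := hi (area A 1 one) - lo (area A 1 one).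
Definition bump_curve A r : R := area A 1 one r - lo (area A 1 one).
Definition tail_curve A r : R :=
  area (-1) (-1) one r - lo (area (-1) (-1) one) + width A.

Lemma is_derive_area1 A sigma r : -1 <= A ->
  is_derive r 1 (area A sigma one) (density A sigma r).
Proof.
move=> A1; rewrite -[density _ _ _]mul1r.
by apply: (is_derive_area k_gt0 sigma r A1); exact: cst_continuous.
Qed.

Lemma is_derive_bump A r : 0 < A -> is_derive r 1 (bump_curve A) (density A 1 r).
Proof.
move=> A0; rewrite -[density _ _ _]subr0; apply: is_deriveBp.
by apply: is_derive_area1; lra.
Qed.

Lemma is_derive_tail A r : is_derive r 1 (tail_curve A) (density (-1) (-1) r).
Proof.
rewrite -[density _ _ _]addr0 -[X in X + 0]subr0; apply: is_deriveDp; apply: is_deriveBp.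
exact: is_derive_area1.
Qed.

Lemma bump_density_gt0 A r : 0 < A -> 0 < density A 1 r.
Proof. by move=> A0; apply: density_gt0 => //; exact: bump_admissible. Qed.

Lemma tail_density_gt0 r : 0 < density (-1) (-1) r.
Proof. by apply: density_gt0 => //; exact: tail_admissible. Qed.

Lemma bump_bounded A : 0 < A -> bounded_range (area A 1 one).
Proof.
move=> A0; apply: (@bump_area_bounded _ _ k_gt0 A one 1 A0); first exact: cst_continuous.
move=> q _; rewrite ler01 mul1r -[leLHS](expr1n _ 2) ler_pXn2r ?nnegrE//;
  by have := sqr_ge0 q; lra.
Qed.

(** For r <= 0 one has q >= 1 and the density is at most K times the weight, K = 256 / k; for r >= 0
    the area is nonnegative by monotonicity. So the tail starts at a finite abscissa. *)
Lemma tail_lower_bound : exists C, forall r, C <= area (-1) (-1) one r.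
Proof.
have dP r : is_derive r 1 (area (-1) (-1) one) (density (-1) (-1) r).
  exact: is_derive_area1.
have s2 : (-1 : R) ^+ 2 = 1 by rewrite sqrrN expr1n.
pose K := 256 / k; have K0 : 0 < K by apply: divr_gt0 k_gt0; rewrite ltr0n.
exists (- (4 * K)) => r; have [r0|r0] := leP 0 r.
  apply: (@le_trans _ _ 0); first by lra.
  rewrite -(area0 k (-1) (-1) one).
  by apply: (ger0_derive_le r0 (fun s _ => dP s)) => s _; exact/ltW/tail_density_gt0.
have := @ler_incr_derive R (area (-1) (-1) one) (fun s => K * weight_primitive (-1) s)
  _ _ r 0 (ltW r0) (fun s _ => dP s)
  (fun s _ => is_deriveZp K (is_derive_weight_primitive s s2)).
rewrite area0 => H.
have {}H : 0 - area (-1) (-1) one r <=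
    K * weight_primitive (-1) 0 - K * weight_primitive (-1) r.
  apply: H => s /andP[rs s0].
  apply: (le_trans (tail_density_le k_gt0 s)).
  have q1 : 1 <= steep (-1) s by rewrite /steep -[leLHS]expR0 ler_expR; lra.
  have gw := gauss_weight (-1) s.
  have -> : K * weight (-1) s = 256 * weight (-1) s / k by rewrite /K mulrAC.
  rewrite ler_pM2r ?invr_gt0//; apply: le_trans gw.
  have g0 := gauss_gt0 (steep (-1) s).
  rewrite -mulrA ler_pM2l//.
  have D : 1 <= 1 + steep (-1) s ^+ 2 by have := sqr_ge0 (steep (-1) s); lra.
  rewrite -[leLHS]mul1r ler_pM//; first by lra.
  by rewrite [leRHS]exprS ler_peMr ?exprn_ege1//; lra.
have := weight_primitive_le2 0 s2; have := weight_primitive_le2 r s2.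
by rewrite !ler_norml => /andP[a1 a2] /andP[b1 b2]; nra.
Qed.

Lemma tail_unbounded C : exists r, C < area (-1) (-1) one r.
Proof.
have dP r : is_derive r 1 (area (-1) (-1) one) (density (-1) (-1) r).
  exact: is_derive_area1.
pose e := expR (-1) / k; have e0 : 0 < e by rewrite divr_gt0// expR_gt0.
pose r := (`|C| + 1) / e; have r0 : 0 <= r.
  by apply: divr_ge0 (ltW e0); have := normr_ge0 C; lra.
exists r.
have := @ler_incr_derive R (fun s => e * s) (area (-1) (-1) one) (fun=> e * 1) _
  0 r r0 (fun s _ => is_deriveZp e (is_derive_idp s)) (fun s _ => dP s).
rewrite area0 mulr0 !subr0 {1}/r mulrCA divff ?gt_eqF// mulr1 => H.
apply: lt_le_trans (H _); first by have := ler_norm C; lra.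
by move=> s /andP[s0 _]; exact: tail_density_ge.
Qed.

Lemma bump_range A y : 0 < A ->
  open_range (bump_curve A) y <-> 0 < y < width A.
Proof.
move=> A0; have bA := bump_bounded A0; rewrite /bump_curve /width; split.
  move=> [a [b /andP[ay yb]]]; have := ge_lo a bA; have := le_hi b bA.
  by move=> *; apply/andP; split; lra.
move=> /andP[y0 yw].
have [a ha] : exists a, area A 1 one a < y + lo (area A 1 one) by apply: lo_lt; lra.
have [b hb] : exists b, y + lo (area A 1 one) < area A 1 one b by apply: hi_gt; lra.
by exists a, b; apply/andP; split; lra.
Qed.

Lemma bump_mem A r : 0 < A -> 0 < bump_curve A r < width A.
Proof.
move=> A0; apply/bump_range => //.
exact: (open_rangeF (fun s => is_derive_bump s A0) (fun s => bump_density_gt0 s A0)).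
Qed.

Lemma width_gt0 A : 0 < A -> 0 < width A.
Proof. by move=> /(bump_mem 0)/andP[a b]; exact: lt_trans b. Qed.

Lemma tail_range A y : open_range (tail_curve A) y <-> width A < y.
Proof.
have [C HC] := tail_lower_bound.
have ge_lo_tail r : lo (area (-1) (-1) one) <= area (-1) (-1) one r.
  by apply: ge_inf; [exists C => _ [s _ <-]|exists r].
rewrite /tail_curve; split.
  by move=> [a [b /andP[ay yb]]]; have := ge_lo_tail a; lra.
move=> wy; set l := lo _ in ge_lo_tail *.
have [a ha] : exists a, area (-1) (-1) one a < y - width A + l by apply: lo_lt; rewrite -/l; lra.
have [b hb] := tail_unbounded (y - width A + l).
by exists a, b; apply/andP; split; lra.
Qed.

Lemma tail_mem A r : width A < tail_curve A r.
Proof.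
apply/tail_range.
exact: (open_rangeF (fun s => is_derive_tail A s) tail_density_gt0).
Qed.

(** The value 0 at [width A] replaces an infinite slope. The value at x = 0 is the true slope at the
    top; the wave evaluates this function at |x| only. *)
Definition slope A x : R :=
  if x <= 0 then 0 else if x < width A then steep 1 (inverse (bump_curve A) x)
  else if x == width A then 0 else steep (-1) (inverse (tail_curve A) x).

(** Amplitude 0 at [width A] makes the height equal to 1 there, the common limit of crest and
    tail. *)
Definition amplitude A x : R :=
  if x < width A then A else if x == width A then 0 else -1.

Lemma slope_bump A x : 0 < x < width A ->
  slope A x = steep 1 (inverse (bump_curve A) x).
Proof. by move=> /andP[x0 xw]; rewrite /slope leNgt x0 xw. Qed.

Lemma slope_tail A x : 0 < A -> width A < x ->
  slope A x = steep (-1) (inverse (tail_curve A) x).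
Proof.
move=> A0 wx; rewrite /slope leNgt (lt_trans (width_gt0 A0) wx)/=.
by rewrite ltNge (ltW wx)/= gt_eqF.
Qed.

Lemma slope_width A : slope A (width A) = 0.
Proof. by rewrite /slope ltxx eqxx; case: ifP. Qed.

Lemma slope_le0 A x : x <= 0 -> slope A x = 0.
Proof. by rewrite /slope => ->. Qed.

Lemma amplitude_bump A x : x < width A -> amplitude A x = A.
Proof. by rewrite /amplitude => ->. Qed.

Lemma amplitude_tail A x : width A < x -> amplitude A x = -1.
Proof. by move=> wx; rewrite /amplitude ltNge (ltW wx)/= gt_eqF. Qed.

Lemma amplitude_width A : amplitude A (width A) = 0.
Proof. by rewrite /amplitude ltxx eqxx. Qed.

Lemma slope_gt0 A x : 0 < A -> 0 < x -> x != width A -> 0 < slope A x.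
Proof.
move=> A0 x0; rewrite neq_lt => /orP[xw|wx].
  by rewrite slope_bump ?x0// steep_gt0.
by rewrite slope_tail// steep_gt0.
Qed.

Lemma slope_ge0 A x : 0 <= slope A x.
Proof. by rewrite /slope; repeat case: ifP => _ //; exact/ltW/steep_gt0. Qed.

Lemma near_bump A x : 0 < x < width A -> \forall y \near x, 0 < y < width A.
Proof.
move=> /andP[x0 xw]; near=> y; apply/andP; split; near: y.
  exact: lt_nbhsr.
exact: lt_nbhsl.
Unshelve. all: by end_near. Qed.

Lemma near_tail A x : width A < x -> \forall y \near x, width A < y.
Proof. by move=> wx; exact: lt_nbhsr. Qed.

(** One chain rule for both pieces: [amplitude] is locally constant, and the x-derivative is the
    r-derivative divided by the density. [sigma] and [r] are existential so that users need not
    separate crest from tail. *)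
Lemma derive_along_slope A x (H : R -> R -> R) (g : R -> R -> R -> R) :
  0 < A -> 0 < x -> x != width A ->
  (forall a sigma (r : R), admissible a sigma ->
     is_derive r 1 (fun r => H a (steep sigma r)) (g a sigma r)) ->
  exists sigma r, [/\ admissible (amplitude A x) sigma, steep sigma r = slope A x
    & is_derive x 1 (fun y => H (amplitude A y) (slope A y))
      (g (amplitude A x) sigma r / density (amplitude A x) sigma r)].
Proof.
move=> A0 x0; rewrite neq_lt => /orP[xw|wx] dH.
  have xI : 0 < x < width A by rewrite x0.
  have ad := bump_admissible A0; exists 1, (inverse (bump_curve A) x).
  rewrite (amplitude_bump xw) (slope_bump xI).
  have := @is_derive_along R _ _ (fun s => is_derive_bump s A0)
    (fun s => bump_density_gt0 s A0) (fun r => H A (steep 1 r)) (g A 1) x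
    ((bump_range x A0).2 xI) (fun r => dH _ _ r ad).
  move=> d; split; [exact: ad|by []|].
  apply: near_eq_is_derive d.
  apply: filterS (near_bump xI) => y yI /=.
  by rewrite slope_bump// amplitude_bump//; case/andP: yI.
have ad := tail_admissible R; exists (-1), (inverse (tail_curve A) x).
rewrite (amplitude_tail wx) (slope_tail A0 wx).
have := @is_derive_along R _ _ (is_derive_tail A) tail_density_gt0
  (fun r => H (-1) (steep (-1) r)) (g (-1) (-1)) x
  ((tail_range A x).2 wx) (fun r => dH _ _ r ad).
move=> d; split; [exact: ad|by []|].
apply: near_eq_is_derive d.
apply: filterS (near_tail wx) => y yI /=.
by rewrite slope_tail// amplitude_tail.
Qed.

Lemma is_derive_profile_height A x : 0 < A -> 0 < x -> x != width A ->
  is_derive x 1 (fun y => height (amplitude A y) (slope A y)) (- (k * slope A x)).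
Proof.
move=> A0 x0 xw.
have [|sigma [r [ad sK d]]] := derive_along_slope A0 x0 xw (H := @height R)
  (g := fun a sigma r => - (sigma * a * steep sigma r ^+ 2 * gauss (steep sigma r))
       / height a (steep sigma r)).
  by move=> a sigma r [_ _ a1]; exact: is_derive_height.
by apply: (is_derive_eq d); rewrite height_density// sK.
Qed.

Lemma is_derive_profile_flux A x : 0 < A -> 0 < x -> x != width A ->
  is_derive x 1 (fun y => amplitude A y * gauss (slope A y) * slope A y)
    (k * height (amplitude A x) (slope A x) * (1 - 2 * slope A x ^+ 2)).
Proof.
move=> A0 x0 xw.
have [|sigma [r [ad sK d]]] := derive_along_slope A0 x0 xw (H := fun a q => a * gauss q * q)
  (g := fun a sigma r => sigma * a * gauss (steep sigma r) * steep sigma r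
     * (1 - 2 * steep sigma r ^+ 2)).
  by move=> a sigma r _; exact: is_derive_flux.
by apply: (is_derive_eq d); rewrite flux_density// sK.
Qed.

Lemma continuous_slope A x : 0 < A -> 0 < x -> x != width A ->
  {for x, continuous (slope A)}.
Proof.
move=> A0 x0 xw.
have [|sigma [r [ad sK d]]] := derive_along_slope A0 x0 xw (H := fun a q => q)
  (g := fun a sigma r => sigma * steep sigma r).
  by move=> a sigma r _; exact: is_derive_steep.
exact: is_derive_continuous d.
Qed.

Lemma amplitude_admissible A x : 0 < A -> -1 <= amplitude A x <= A.
Proof. by move=> A0; rewrite /amplitude; repeat case: ifP => _; lra. Qed.

(** On the crest q = exp r increases with x, so q < e holds before the point of parameter ln e. The
    next two bounds use ln N on the crest and, since q = exp(-r) on the tail, - ln N and - ln e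
    there. *)
Lemma slope_near0 A e : 0 < A -> 0 < e ->
  exists2 d, 0 < d & forall x, 0 < x < d -> x < width A /\ slope A x < e.
Proof.
move=> A0 e0; have /andP[F0 Fw] := bump_mem (ln e) A0.
exists (bump_curve A (ln e)) => // x /andP[x0 xF].
have xw := lt_trans xF Fw; split => //.
have xI : 0 < x < width A by rewrite x0.
rewrite slope_bump// /steep mul1r -[ltRHS](lnK e0) ltr_expR.
have dF := fun s => is_derive_bump s A0; have d0 := fun s => bump_density_gt0 s A0.
rewrite -(curve_lt_mono dF d0) (open_range_inverse dF d0)//.
exact/bump_range.
Qed.

Lemma slope_near_width A N : 0 < A -> 0 < N ->
  exists2 d, 0 < d & forall x, `|x - width A| < d -> x != width A -> N < slope A x.
Proof.
move=> A0 N0; have /andP[F0 Fw] := bump_mem (ln N) A0.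
have wT := tail_mem A (- ln N).
exists (Num.min (width A - bump_curve A (ln N)) (tail_curve A (- ln N) - width A)).
  by rewrite lt_min !subr_gt0 Fw.
move=> x; rewrite lt_min !ltr_norml => /andP[/andP[h1 _] /andP[_ h2]].
rewrite neq_lt => /orP[xw|wx].
  have xF : bump_curve A (ln N) < x by lra.
  have xI : 0 < x < width A by rewrite (lt_trans F0 xF).
  rewrite slope_bump// /steep mul1r -[ltLHS](lnK N0) ltr_expR.
  have dF := fun s => is_derive_bump s A0; have d0 := fun s => bump_density_gt0 s A0.
  rewrite -(curve_lt_mono dF d0) (open_range_inverse dF d0)//.
  exact/bump_range.
rewrite slope_tail// /steep mulN1r -[ltLHS](lnK N0) ltr_expR ltrNr.
rewrite -(curve_lt_mono (is_derive_tail A) tail_density_gt0).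
rewrite (open_range_inverse (is_derive_tail A) tail_density_gt0); last exact/tail_range.
lra.
Qed.

Lemma slope_infty A e : 0 < A -> 0 < e ->
  exists2 N, width A < N & forall x, N <= x -> slope A x < e.
Proof.
move=> A0 e0; have wT := tail_mem A (- ln e).
exists (tail_curve A (- ln e) + 1); first by lra.
move=> x Nx; have wx : width A < x by lra.
rewrite slope_tail// /steep mulN1r -[ltRHS](lnK e0) ltr_expR ltrNl.
rewrite -(curve_lt_mono (is_derive_tail A) tail_density_gt0).
rewrite (open_range_inverse (is_derive_tail A) tail_density_gt0); last exact/tail_range.
lra.
Qed.

End Profile.

(** * Continuity in the amplitude *)

Section ParameterContinuity.
Variable R : realType.
Variable k : R.
Hypothesis k_gt0 : 0 < k.
Implicit Types (A B M q r x y : R).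

Local Notation one := (fun _ : R => 1 : R).
Local Notation area := (area k).
Local Notation density := (density k).
Local Notation width := (width k).
Local Notation bump_curve := (bump_curve k).
Local Notation tail_curve := (tail_curve k).
Local Notation slope := (slope k).
Local Notation amplitude := (amplitude k).

(** Convergence at the two parameters r0 - e and r0 + e suffices: the values there enclose x for A
    near A0, and monotonicity traps the inverse between them. *)
Lemma inverse_cvg (F_ rho_ : R -> R -> R) A0 x :
  (\forall A \near A0, (forall r : R, is_derive r 1 (F_ A) (rho_ A r)) /\
     (forall r, 0 < rho_ A r)) ->
  (forall r, F_ A r @[A --> A0] --> F_ A0 r) -> open_range (F_ A0) x ->
  inverse (F_ A) x @[A --> A0] --> inverse (F_ A0) x.
Proof.
move=> nearF cF xF; have [dF0 rho0] := nbhs_singleton nearF.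
apply/cvgrPdist_lt => e e0; set r0 := inverse _ _.
have Fr0 : F_ A0 r0 = x := open_range_inverse dF0 rho0 xF.
have la : F_ A0 (r0 - e) < x by rewrite -Fr0 (curve_lt_mono dF0 rho0); lra.
have lb : x < F_ A0 (r0 + e) by rewrite -Fr0 (curve_lt_mono dF0 rho0); lra.
near=> A; have [dF rhoA] : (forall r : R, is_derive r 1 (F_ A) (rho_ A r)) /\
    (forall r, 0 < rho_ A r) by near: A.
have hA : F_ A (r0 - e) < x by near: A; exact: (cvgr_lt _ (cF _)).
have hB : x < F_ A (r0 + e) by near: A; exact: (cvgr_gt _ (cF _)).
have [_ h1 h2] : [/\ F_ A (inverse (F_ A) x) = x, r0 - e < inverse (F_ A) x
    & inverse (F_ A) x < r0 + e].
  by apply: (inverse_range dF rhoA); rewrite hA.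
by rewrite ltr_distl; lra.
Unshelve. all: by end_near. Qed.

Lemma lipschitz_cvg (f : R -> R) A0 C : 0 < A0 ->
  (forall A, 0 < A -> A <= A0 + 1 -> `|f A - f A0| <= C * `|A - A0|) ->
  f A @[A --> A0] --> f A0.
Proof.
move=> A0_gt0 H; apply/cvgrPdist_le => e e0; near=> A.
have A_gt0 : 0 < A by near: A; exact: lt_nbhsr.
have A1 : A < A0 + 1 by near: A; apply: lt_nbhsl; lra.
rewrite distrC (le_trans (H A A_gt0 (ltW A1)))//.
apply: (@le_trans _ _ ((`|C| + 1) * `|A - A0|)).
  by rewrite ler_wpM2r//; have := ler_norm C; lra.
rewrite mulrC -ler_pdivlMr; last by have := normr_ge0 C; lra.
rewrite distrC; near: A; apply: cvgr_dist_le; first exact: cvg_id.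
by rewrite divr_gt0//; have := normr_ge0 C; lra.
Unshelve. all: by end_near. Qed.

Definition total_area A sigma (h : R -> R) := hi (area A sigma h) - lo (area A sigma h).

Lemma bump_area_close A B (hA hB : R -> R) K r : 0 < A -> 0 < B ->
  continuous hA -> continuous hB -> 0 <= K ->
  (forall r, `|hA (steep 1 r) * density A 1 r - hB (steep 1 r) * density B 1 r|
     <= K * weight 1 r) ->
  `|area A 1 hA r - area B 1 hB r| <= 4 * K.
Proof.
move=> A0 B0 cA cB K0 H.
have s2 : (1 : R) ^+ 2 = 1 by rewrite expr1n.
have A1 : -1 <= A by lra.
have B1 : -1 <= B by lra.
apply: (@dominated_derive R (fun r => area A 1 hA r - area B 1 hB r)
  (fun r => hA (steep 1 r) * density A 1 r - hB (steep 1 r) * density B 1 r)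
  (weight_primitive 1) (weight 1) K r
  (fun s => is_deriveBp (is_derive_area k_gt0 1 s A1 cA) (is_derive_area k_gt0 1 s B1 cB))
  (fun s => is_derive_weight_primitive s s2) (fun s => weight_primitive_le2 s s2)
  K0 H).
by rewrite !area0 subrr.
Qed.

Lemma gauss_weight_le (C : R) q2 r : 0 <= C -> 0 <= q2 <= (1 + steep 1 r ^+ 2) ^+ 2 ->
  q2 * (C * (gauss (steep 1 r) * steep 1 r)) <= 256 * C * weight 1 r.
Proof.
move=> C0 /andP[q20 q2le].
have q0 := steep_gt0 1 r; have g0 := gauss_gt0 (steep 1 r).
have gw := gauss_weight 1 r.
have D : 1 <= 1 + steep 1 r ^+ 2 by have := sqr_ge0 (steep 1 r); lra.
have -> : q2 * (C * (gauss (steep 1 r) * steep 1 r))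
  = C * (gauss (steep 1 r) * steep 1 r * q2) by ring.
have -> : 256 * C * weight 1 r = C * (256 * weight 1 r) by ring.
rewrite ler_wpM2l//; apply: le_trans gw.
have P0 : 0 <= gauss (steep 1 r) * steep 1 r by apply: mulr_ge0; exact: ltW.
apply: (ler_wpM2l P0); apply: (le_trans q2le).
by rewrite [leRHS]exprS ler_peMl// exprn_ge0//; lra.
Qed.

Lemma height_ge1 A q : 0 < A -> 1 <= height A q.
Proof.
move=> A0; rewrite /height -[leLHS]sqrtr1 ler_wsqrtr// lerDl.
by apply: mulr_ge0; [exact: ltW|exact/ltW/gauss_gt0].
Qed.

Lemma bump_density_close A B M (h : R -> R) r : 0 < A -> 0 < B -> A <= M -> B <= M ->
  (forall q, 0 <= h q <= (1 + q ^+ 2) ^+ 2) ->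
  `|h (steep 1 r) * density A 1 r - h (steep 1 r) * density B 1 r|
  <= (256 * ((1 + M) / k)) * `|A - B| * weight 1 r.
Proof.
move=> A0 B0 AM BM hq.
have hA := height_ge1 (steep 1 r) A0; have hB := height_ge1 (steep 1 r) B0.
have A1 : -1 <= A by lra.
have B1 : -1 <= B by lra.
have g01 : 0 <= gauss (steep 1 r) <= 1 by rewrite ltW ?gauss_gt0 ?gauss_le1.
have := lipschitz_div_height A0 B0 AM BM g01 hA hB (sqr_height _ A1) (sqr_height _ B1).
have q0 := steep_gt0 1 r; have g0 := gauss_gt0 (steep 1 r).
have /andP[h0 hle] := hq (steep 1 r).
have E : h (steep 1 r) * density A 1 r - h (steep 1 r) * density B 1 r
  = h (steep 1 r) * ((k^-1 * (gauss (steep 1 r) * steep 1 r)) *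
     (A / height A (steep 1 r) - B / height B (steep 1 r))).
  rewrite /density; field.
  by rewrite !gt_eqF//; lra.
rewrite E normrM [`|h _|]ger0_norm// normrM.
have P0 : 0 <= k^-1 * (gauss (steep 1 r) * steep 1 r).
  by apply: mulr_ge0; [rewrite invr_ge0; exact: ltW|apply: mulr_ge0; exact: ltW].
rewrite [X in _ * (X * _)]ger0_norm// => H.
apply: (le_trans (ler_wpM2l h0 (ler_wpM2l P0 H))).
have -> : h (steep 1 r) * (k^-1 * (gauss (steep 1 r) * steep 1 r) * ((1 + M) * `|A - B|))
  = h (steep 1 r) * ((1 + M) / k * `|A - B| * (gauss (steep 1 r) * steep 1 r)) by ring.
have -> : 256 * ((1 + M) / k) * `|A - B| = 256 * ((1 + M) / k * `|A - B|) by ring.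
apply: gauss_weight_le; last by rewrite h0.
apply: mulr_ge0 => //; apply: divr_ge0 (ltW k_gt0); lra.
Qed.

Lemma bump_height_close A B M r : 0 < A -> 0 < B -> A <= M -> B <= M ->
  `|(1 + A * gauss (steep 1 r)) * density A 1 r
    - (1 + B * gauss (steep 1 r)) * density B 1 r|
  <= (256 * ((1 + 2 * M) / k)) * `|A - B| * weight 1 r.
Proof.
move=> A0 B0 AM BM.
have hA := height_ge1 (steep 1 r) A0; have hB := height_ge1 (steep 1 r) B0.
have A1 : -1 <= A by lra.
have B1 : -1 <= B by lra.
have g01 : 0 <= gauss (steep 1 r) <= 1 by rewrite ltW ?gauss_gt0 ?gauss_le1.
have := lipschitz_mul_height A0 B0 AM BM g01 hA hB (sqr_height _ A1) (sqr_height _ B1).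
have q0 := steep_gt0 1 r; have g0 := gauss_gt0 (steep 1 r).
rewrite -(sqr_height _ A1) -(sqr_height _ B1).
have -> : height A (steep 1 r) ^+ 2 * density A 1 r - height B (steep 1 r) ^+ 2 * density B 1 r
  = (k^-1 * (gauss (steep 1 r) * steep 1 r)) *
     (A * height A (steep 1 r) - B * height B (steep 1 r)).
  rewrite /density; field.
  by rewrite !gt_eqF//; lra.
rewrite normrM.
have P0 : 0 <= k^-1 * (gauss (steep 1 r) * steep 1 r).
  by apply: mulr_ge0; [rewrite invr_ge0; exact: ltW|apply: mulr_ge0; exact: ltW].
rewrite [X in X * _ <= _]ger0_norm// => H.
apply: (le_trans (ler_wpM2l P0 H)).
have -> : k^-1 * (gauss (steep 1 r) * steep 1 r) * ((1 + 2 * M) * `|A - B|)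
  = 1 * ((1 + 2 * M) / k * `|A - B| * (gauss (steep 1 r) * steep 1 r)) by ring.
have -> : 256 * ((1 + 2 * M) / k) * `|A - B| = 256 * ((1 + 2 * M) / k * `|A - B|) by ring.
apply: gauss_weight_le; last first.
  by rewrite ler01 exprn_ege1//; have := sqr_ge0 (steep 1 r); lra.
apply: mulr_ge0 => //; apply: divr_ge0 (ltW k_gt0); lra.
Qed.

(** The Lipschitz bound is uniform in r, so it passes to supremum and infimum, hence to integrals
    over whole pieces, without an interchange of limits. *)
Lemma area_family_cvg (h : R -> R -> R) A0 C : 0 < A0 -> 0 <= C ->
  (forall A, 0 < A -> continuous (h A)) ->
  (forall A, 0 < A -> bounded_range (area A 1 (h A))) ->
  (forall A r, 0 < A -> A <= A0 + 1 ->
    `|h A (steep 1 r) * density A 1 r - h A0 (steep 1 r) * density A0 1 r|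
      <= C * `|A - A0| * weight 1 r) ->
  [/\ forall r, area A 1 (h A) r @[A --> A0] --> area A0 1 (h A0) r,
      lo (area A 1 (h A)) @[A --> A0] --> lo (area A0 1 (h A0))
    & hi (area A 1 (h A)) @[A --> A0] --> hi (area A0 1 (h A0))].
Proof.
move=> A0_gt0 C0 ch bh H.
have K A r : 0 < A -> A <= A0 + 1 ->
    `|area A 1 (h A) r - area A0 1 (h A0) r| <= 4 * C * `|A - A0|.
  move=> A_gt0 AA0; rewrite -mulrA; apply: bump_area_close => //.
  - exact: ch.
  - exact: ch.
  - exact: mulr_ge0.
  - by move=> s; exact: H.
split => [r||]; apply: (@lipschitz_cvg _ _ (4 * C) A0_gt0) => A A_gt0 AA0.
- exact: K.
- apply: lo_close; [exact: bh|exact: bh|by move=> r; exact: K].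
- apply: hi_close; [exact: bh|exact: bh|by move=> r; exact: K].
Qed.

Lemma area_one_cvg A0 : 0 < A0 ->
  [/\ forall r, area A 1 one r @[A --> A0] --> area A0 1 one r,
      lo (area A 1 one) @[A --> A0] --> lo (area A0 1 one)
    & hi (area A 1 one) @[A --> A0] --> hi (area A0 1 one)].
Proof.
move=> A0_gt0; apply: (@area_family_cvg (fun _ => one) A0 (256 * ((1 + (A0 + 1)) / k)) A0_gt0).
- by apply: mulr_ge0; [rewrite ler0n|apply: divr_ge0 (ltW k_gt0); lra].
- by move=> A _; exact: cst_continuous.
- by move=> A; exact: bump_bounded.
- move=> A r A_gt0 AA0; apply: (@bump_density_close _ _ _ one) => //; first by lra.
  by move=> q; rewrite ler01 exprn_ege1//; have := sqr_ge0 q; lra.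
Qed.

Lemma width_cvg A0 : 0 < A0 -> width A @[A --> A0] --> width A0.
Proof. by move=> /area_one_cvg[_ h1 h2]; exact: cvgB. Qed.

Lemma bump_curve_cvg A0 r : 0 < A0 -> bump_curve A r @[A --> A0] --> bump_curve A0 r.
Proof. by move=> /area_one_cvg[h0 h1 _]; exact: cvgB. Qed.

Lemma tail_curve_cvg A0 r : 0 < A0 -> tail_curve A r @[A --> A0] --> tail_curve A0 r.
Proof. by move=> /width_cvg h; apply: cvgD h; exact: cvg_cst. Qed.

Lemma near_bump_param A0 x : 0 < A0 -> 0 < x < width A0 ->
  \forall A \near A0, 0 < A /\ 0 < x < width A.
Proof.
move=> A0_gt0 /andP[x0 xw]; near=> A; split; first by near: A; exact: lt_nbhsr.
by rewrite x0/=; near: A; exact: (cvgr_gt _ (width_cvg A0_gt0)).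
Unshelve. all: by end_near. Qed.

Lemma near_tail_param A0 x : 0 < A0 -> width A0 < x ->
  \forall A \near A0, 0 < A /\ width A < x.
Proof.
move=> A0_gt0 wx; near=> A; split; first by near: A; exact: lt_nbhsr.
by near: A; exact: (cvgr_lt _ (width_cvg A0_gt0)).
Unshelve. all: by end_near. Qed.

(** Since [width] is continuous, x stays on the same piece for A near A0, and convergence of the
    curves passes to their inverses. *)
Lemma slope_cvg A0 x : 0 < A0 -> x != width A0 ->
  slope A x @[A --> A0] --> slope A0 x.
Proof.
move=> A0_gt0 xw; have [x0|x0] := leP x 0.
  rewrite slope_le0//; apply: cvg_near_cst; apply: nearW => A.
  by rewrite slope_le0.
move: xw; rewrite neq_lt => /orP[xw|wx].
  have xI : 0 < x < width A0 by rewrite x0.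
  rewrite (slope_bump xI).
  apply: (@cvg_trans _ (steep 1 (inverse (bump_curve A) x) @[A --> A0])).
    apply: near_eq_cvg; apply: filterS (near_bump_param A0_gt0 xI) => A [A_gt0 xA].
    by rewrite slope_bump.
  have H : inverse (bump_curve A) x @[A --> A0] --> inverse (bump_curve A0) x.
    apply: (@inverse_cvg bump_curve (fun A => density A 1)).
    - near=> A; have A_gt0 : 0 < A by near: A; exact: lt_nbhsr.
      by split => r; [exact: is_derive_bump|exact: bump_density_gt0].
    - by move=> r; exact: bump_curve_cvg.
    - exact/bump_range.
  exact: (cvg_comp _ _ H (@continuous_steep R 1 _)).
rewrite slope_tail//.
apply: (@cvg_trans _ (steep (-1) (inverse (tail_curve A) x) @[A --> A0])).
  apply: near_eq_cvg; apply: filterS (near_tail_param A0_gt0 wx) => A [A_gt0 xA].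
  by rewrite slope_tail.
have H : inverse (tail_curve A) x @[A --> A0] --> inverse (tail_curve A0) x.
  apply: (@inverse_cvg tail_curve (fun A => density (-1) (-1))).
  - by near=> A; split => r; [exact: is_derive_tail|exact: tail_density_gt0].
  - by move=> r; exact: tail_curve_cvg.
  - exact/tail_range.
exact: (cvg_comp _ _ H (@continuous_steep R (-1) _)).
Unshelve. all: by end_near. Qed.

Lemma amplitude_cvg A0 x : 0 < A0 -> 0 < x -> x != width A0 ->
  amplitude A x @[A --> A0] --> amplitude A0 x.
Proof.
move=> A0_gt0 x0; rewrite neq_lt => /orP[xw|wx].
  have xI : 0 < x < width A0 by rewrite x0.
  rewrite amplitude_bump//.
  apply: (@cvg_trans _ (A @[A --> A0])); last exact: cvg_id.
  apply: near_eq_cvg; apply: filterS (near_bump_param A0_gt0 xI) => A [_ /andP[_ xA]].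
  by rewrite amplitude_bump.
rewrite amplitude_tail//; apply: cvg_near_cst.
apply: filterS (near_tail_param A0_gt0 wx) => A [_ xA].
by rewrite amplitude_tail.
Qed.

End ParameterContinuity.

(** * Integrals over the line of even functions of the slope *)

Section ProfileIntegral.
Variable R : realType.
Notation mu := (@lebesgue_measure R).
Variable k : R.
Hypothesis k_gt0 : 0 < k.
Implicit Types (A q r x y : R).

Local Notation area := (area k).
Local Notation width := (width k).
Local Notation slope := (slope k).

Lemma measurable_even_off (g : R -> R) w :
  (forall x, 0 < x -> x != w -> {for x, continuous g}) ->
  measurable_fun setT (fun x => g `|x|).
Proof.
move=> cg; apply: (@measurable_continuous_off R [:: 0; w; - w]) => x.
rewrite !inE !negb_or => /and3P[x0 xw xNw].
apply: (@continuous_comp _ _ _ (fun x : R => `|x|) g); first exact: norm_continuous.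
apply: cg; first by rewrite normr_gt0.
have [x_ge0|x_lt0] := leP 0 x; first by rewrite ger0_norm.
by rewrite ltr0_norm// eqr_oppLR.
Qed.

(** Crest and tail get separate formulas because u^2 involves the amplitude. The function is 0 off
    the open ranges of the two curves. *)
Definition spread A (h1 h2 : R -> R) y : R :=
  if 0 < y < width A then h1 (slope A y)
  else if width A < y then h2 (slope A y) else 0.

Lemma measurable_spread A (h1 h2 : R -> R) : 0 < A -> continuous h1 -> continuous h2 ->
  measurable_fun setT (fun x => spread A h1 h2 `|x|).
Proof.
move=> A0 c1 c2; apply: (@measurable_even_off _ (width A)) => x x0 xw.
have cs := continuous_slope k_gt0 A0 x0 xw.
move: (xw); rewrite neq_lt => /orP[xl|xr].
  have xI : 0 < x < width A by rewrite x0.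
  apply: (@cvg_trans _ (h1 (slope A y) @[y --> x])).
    apply: near_eq_cvg; apply: filterS (near_bump xI) => y yI.
    by rewrite /spread yI.
  rewrite /spread xI; exact: (continuous_cvg _ (c1 _) cs).
apply: (@cvg_trans _ (h2 (slope A y) @[y --> x])).
  apply: near_eq_cvg; apply: filterS (near_tail xr) => y yI.
  by rewrite /spread yI [y < _]ltNge (ltW yI) andbF.
rewrite /spread xr [x < _]ltNge (ltW xr) andbF.
exact: (continuous_cvg _ (c2 _) cs).
Qed.

(** Each curve contributes the total area along it by the change of variables, and the mirror images
    double the sum. *)
Lemma profile_integral A (h1 h2 : R -> R) : 0 < A ->
  continuous h1 -> continuous h2 -> (forall q, 0 <= h1 q) -> (forall q, 0 <= h2 q) ->
  bounded_range (area A 1 h1) -> bounded_range (area (-1) (-1) h2) ->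
  (\int[mu]_x (spread A h1 h2 `|x|)%:E
   = (2 * (total_area k A 1 h1 + total_area k (-1) (-1) h2))%:E)%E.
Proof.
move=> A0 c1 c2 p1 p2 b1 b2.
have A1 : -1 <= A by lra.
have ms := measurable_spread A0 c1 c2.
pose F1 := bump_curve k A; pose F2 := tail_curve k A.
pose D1 : set R := open_range F1; pose N1 : set R := [set x | open_range F1 (- x)].
pose D2 : set R := open_range F2; pose N2 : set R := [set x | open_range F2 (- x)].
have mO F : measurable (open_range F : set R).
  by apply: open_measurable; exact: open_range_open.
have mN F : measurable ([set x | open_range F (- x)] : set R).
  apply: open_measurable; apply: open_comp; last exact: open_range_open.
  by move=> x _; exact: opp_continuous.
have d1 r := is_derive_bump k_gt0 r A0; have g1 r := bump_density_gt0 k_gt0 r A0.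
have d2 := is_derive_tail k_gt0 A; have g2 := tail_density_gt0 k_gt0.
have w0 := width_gt0 k_gt0 A0.
have R1 x : open_range F1 x <-> 0 < x < width A by exact: bump_range.
have R2 x : open_range F2 x <-> width A < x by exact: tail_range.
have S1 x : open_range F1 x -> spread A h1 h2 x = h1 (steep 1 (inverse F1 x)).
  by move=> /R1 xI; rewrite /spread xI slope_bump.
have S2 x : open_range F2 x -> spread A h1 h2 x = h2 (steep (-1) (inverse F2 x)).
  move=> /R2 wx; rewrite /spread wx [x < _]ltNge (ltW wx) andbF slope_tail//.
have E1 r : is_derive r 1 (area A 1 h1) (h1 (steep 1 r) * density k A 1 r).
  exact: is_derive_area.
have E2 r : is_derive r 1 (area (-1) (-1) h2) (h2 (steep (-1) r) * density k (-1) (-1) r).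
  exact: is_derive_area.
have ch1 : continuous (fun r => h1 (steep 1 r)).
  by move=> r; apply: continuous_comp; [exact: continuous_steep|exact: c1].
have ch2 : continuous (fun r => h2 (steep (-1) r)).
  by move=> r; apply: continuous_comp; [exact: continuous_steep|exact: c2].
have s0 x : (0 <= (spread A h1 h2 `|x|)%:E)%E.
  by rewrite lee_fin /spread; repeat case: ifP => _.
have ID1 : (\int[mu]_(x in D1) (spread A h1 h2 `|x|)%:E = (total_area k A 1 h1)%:E)%E.
  rewrite -(integral_along d1 g1 ch1 (fun r => p1 _) E1 b1).
  apply: eq_integral => x /set_mem xD; rewrite ger0_norm ?S1//.
  by have /R1/andP[/ltW] := xD.
have IN1 : (\int[mu]_(x in N1) (spread A h1 h2 `|x|)%:E = (total_area k A 1 h1)%:E)%E.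
  rewrite -(integral_along_reflect d1 g1 ch1 (fun r => p1 _) E1 b1).
  apply: eq_integral => x /set_mem xD; rewrite -normrN ger0_norm ?S1//.
  by have /R1/andP[/ltW] := xD.
have ID2 : (\int[mu]_(x in D2) (spread A h1 h2 `|x|)%:E = (total_area k (-1) (-1) h2)%:E)%E.
  rewrite -(integral_along d2 g2 ch2 (fun r => p2 _) E2 b2).
  apply: eq_integral => x /set_mem xD; rewrite ger0_norm ?S2//.
  by have /R2 := xD; lra.
have IN2 : (\int[mu]_(x in N2) (spread A h1 h2 `|x|)%:E = (total_area k (-1) (-1) h2)%:E)%E.
  rewrite -(integral_along_reflect d2 g2 ch2 (fun r => p2 _) E2 b2).
  apply: eq_integral => x /set_mem xD; rewrite -normrN ger0_norm ?S2//.
  by have /R2 := xD; lra.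
transitivity (\int[mu]_(x in (D1 `|` N1) `|` (D2 `|` N2)) (spread A h1 h2 `|x|)%:E)%E.
  rewrite [RHS]integral_mkcond; apply: eq_integral => x _.
  rewrite patchE; case: ifPn => //; rewrite notin_setE => nU.
  rewrite /spread; case: ifPn => [xI|_].
    exfalso; apply: nU; left; have [x0|x0] := leP 0 x.
      by left; apply/R1; rewrite -(ger0_norm x0).
    by right; apply/R1; rewrite -(ltr0_norm x0).
  case: ifPn => // xI; exfalso; apply: nU; right; have [x0|x0] := leP 0 x.
    by left; apply/R2; rewrite -(ger0_norm x0).
  by right; apply/R2; rewrite -(ltr0_norm x0).
have split_integral (D N : set R) : measurable D -> measurable N -> [disjoint D & N] ->
    (\int[mu]_(x in D `|` N) (spread A h1 h2 `|x|)%:E =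
     \int[mu]_(x in D) (spread A h1 h2 `|x|)%:E
     + \int[mu]_(x in N) (spread A h1 h2 `|x|)%:E)%E.
  move=> mD mN' dDN.
  rewrite ge0_integral_setU//.
  by apply/measurable_EFinP; apply: measurable_funTS; exact: ms.
have dis12 : [disjoint D1 `|` N1 & D2 `|` N2].
  by apply/disj_setPS => x [] [/R1|/R1] + [/R2|/R2]; lra.
have dis1 : [disjoint D1 & N1] by apply/disj_setPS => x [/R1 + /R1]; lra.
have dis2 : [disjoint D2 & N2] by apply/disj_setPS => x [/R2 + /R2]; lra.
rewrite (split_integral _ _ (measurableU _ _ (mO F1) (mN F1))
  (measurableU _ _ (mO F2) (mN F2)) dis12).
rewrite (split_integral _ _ (mO F1) (mN F1) dis1) (split_integral _ _ (mO F2) (mN F2) dis2).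
rewrite ID1 IN1 ID2 IN2; set a := total_area _ _ _ _; set b := total_area _ _ _ _.
have -> : 2 * (a + b) = a + a + (b + b) by ring.
by [].
Qed.

End ProfileIntegral.

(** * The solitary wave *)

Section Wave.
Variable R : realType.
Variables (k m : R).
Hypotheses (k_gt0 : 0 < k) (m_gt0 : 0 < m).
Implicit Types (A q r x y : R).

Local Notation width := (width k).
Local Notation slope := (slope k).
Local Notation amplitude := (amplitude k).

(* With k = sqrt c and m = sqrt b, wave A is the crest of amplitude A > 0 on
   |x| < width A glued to the tails of amplitude -1. *)
Definition wave A x : R := height (amplitude A `|x|) (slope A `|x|) / m.
Definition wave_deriv A x : R := - (k / m) * (Num.sg x * slope A `|x|).
(** By the first integral, b u^2 - 1 at distance y from the top. *)
Definition excess A y : R := amplitude A y * gauss (slope A y).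
Definition flux A x : R := (1 - m ^+ 2 * wave A x ^+ 2) * wave_deriv A x.
(** The derivative that the weak formulation prescribes for the flux: c u - 2 b u u'^2. *)
Definition flux_deriv A x : R :=
  k ^+ 2 * wave A x - 2 * m ^+ 2 * (wave A x * wave_deriv A x ^+ 2).
(** The point 0 is listed because the formulas pass through |x| and the sign of x. *)
Definition kinks A : seq R := [:: 0; width A; - width A].

Section FixedAmplitude.
Variable A : R.
Hypothesis A_gt0 : 0 < A.

Lemma amplitude_geN1 y : -1 <= amplitude A y.
Proof. by case/andP: (amplitude_admissible k y A_gt0). Qed.

Lemma notin_kinks x : x \notin kinks A ->
  [/\ x != 0, 0 < `|x| & `|x| != width A].
Proof.
rewrite !inE !negb_or => /and3P[x0 xw xNw]; split=> //; first by rewrite normr_gt0.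
have [x_ge0|x_lt0] := leP 0 x; first by rewrite ger0_norm.
by rewrite ltr0_norm// eqr_oppLR.
Qed.

Lemma sqr_wave x : m ^+ 2 * wave A x ^+ 2 = 1 + excess A `|x|.
Proof.
rewrite /wave exprMn sqr_height ?amplitude_geN1// exprVn mulrC -mulrA mulVf ?mulr1//.
by rewrite expf_neq0// gt_eqF.
Qed.

Lemma fluxE x : flux A x = k / m * (Num.sg x * (excess A `|x| * slope A `|x|)).
Proof. by rewrite /flux sqr_wave /wave_deriv; ring. Qed.

Lemma is_derive_wave x : x \notin kinks A -> is_derive x 1 (wave A) (wave_deriv A x).
Proof.
move=> /notin_kinks[x0 x_gt0 xw].
have d := is_derive_comp (is_derive_profile_height k_gt0 A_gt0 x_gt0 xw) (is_derive_norm x0).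
have {}d := is_deriveMp d (is_derive_cstp m^-1 x).
by apply: (is_derive_eq d); rewrite /wave_deriv; ring.
Qed.

Lemma is_derive_flux_wave x : x \notin kinks A -> is_derive x 1 (flux A) (flux_deriv A x).
Proof.
move=> /notin_kinks[x0 x_gt0 xw].
have d := is_derive_comp (is_derive_profile_flux k_gt0 A_gt0 x_gt0 xw) (is_derive_norm x0).
have {}d := is_deriveZp (k / m * Num.sg x) d.
have sg2 : Num.sg x ^+ 2 = 1 by rewrite sqr_sg x0.
have m0 : m != 0 by rewrite gt_eqF.
apply: (near_eq_is_derive (f := fun y => k / m * Num.sg x *
    (amplitude A `|y| * gauss (slope A `|y|) * slope A `|y|))).
  by apply: filterS (near_sg x0) => y ys; rewrite fluxE ys /excess; ring.
apply: (is_derive_eq d); rewrite /flux_deriv /wave_deriv /wave.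
set h := height _ _; set q := slope _ _.
have -> : k / m * Num.sg x * (k * h * (1 - 2 * q ^+ 2) * Num.sg x)
  = k ^+ 2 / m * h * (1 - 2 * q ^+ 2) * (Num.sg x ^+ 2) by ring.
have -> : k ^+ 2 * (h / m) - 2 * m ^+ 2 * (h / m * (- (k / m) * (Num.sg x * q)) ^+ 2)
  = k ^+ 2 * (h / m) - 2 * m ^+ 2 * (h / m * ((k / m) ^+ 2 * q ^+ 2)) * Num.sg x ^+ 2.
  by ring.
by rewrite sg2; field.
Qed.

Lemma continuous_slope_abs x : x \notin kinks A ->
  {for x, continuous (fun y => slope A `|y|)}.
Proof.
move=> /notin_kinks[x0 x_gt0 xw].
apply: (@continuous_comp _ _ _ (fun y : R => `|y|) (slope A)); first exact: norm_continuous.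
exact: continuous_slope.
Qed.

Lemma continuous_wave_deriv x : x \notin kinks A -> {for x, continuous (wave_deriv A)}.
Proof.
move=> xS; have [x0 x_gt0 xw] := notin_kinks xS.
apply: cvgM; first exact: cvg_cst.
apply: cvgM; last exact: continuous_slope_abs.
by apply: cvg_near_cst; exact: near_sg.
Qed.

Lemma continuous_flux_deriv x : x \notin kinks A -> {for x, continuous (flux_deriv A)}.
Proof.
move=> xS; have cw := is_derive_continuous (is_derive_wave xS).
have cd := continuous_wave_deriv xS.
apply: cvgB; first by apply: cvgM; [exact: cvg_cst|exact: cw].
apply: cvgM; first exact: cvg_cst.
apply: cvgM; first exact: cw.
rewrite expr2; under eq_fun do rewrite expr2.
by apply: cvgM; exact: cd.
Qed.

Lemma slope0 : slope A 0 = 0. Proof. by rewrite slope_le0. Qed.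

Lemma continuous_slope0 : {for 0, continuous (slope A)}.
Proof.
apply/cvgrPdist_lt => e e0; rewrite slope0.
have [d d0 Hd] := slope_near0 k_gt0 A_gt0 e0.
near=> y; rewrite sub0r normrN ger0_norm ?slope_ge0//.
have [y0|y0] := leP y 0; first by rewrite slope_le0.
by apply: (Hd y _).2; rewrite y0/=; near: y; exact: lt_nbhsl.
Unshelve. all: by end_near. Qed.

Lemma excess_le y : `|excess A y| <= (A + 1) * gauss (slope A y).
Proof.
rewrite normrM [`|gauss _|]gtr0_norm ?gauss_gt0// ler_wpM2r ?(ltW (gauss_gt0 _))//.
by have := A_gt0; have /andP[a b] := amplitude_admissible k y A_gt0; rewrite ler_norml; lra.
Qed.

(** exp(-q^2) q^2 <= 1 gives |excess| q <= (A + 1) / q, which is below e once q > (A + 1) / e. The 1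
    added in [N] ensures q > 1, so that |excess| is below e as well. *)
Lemma excess_slope_width e : 0 < e -> \forall y \near width A,
  `|excess A y| < e /\ `|excess A y * slope A y| < e.
Proof.
move=> e0; have A0 := A_gt0; pose N := (A + 1) / e + 1.
have N1 : 1 <= N by rewrite /N lerDr divr_ge0//; lra.
have [d d0 Hd] := slope_near_width k_gt0 A_gt0 (lt_le_trans ltr01 N1).
have nearw : \forall y \near width A, `|width A - y| < d.
  by apply/nbhs_ballP; exists d.
apply: filterS nearw => y; rewrite distrC => yd.
have [->|yw] := eqVneq y (width A).
  by rewrite /excess amplitude_width !mul0r normr0.
have Nq := Hd y yd yw; set q := slope A y in Nq *.
have q1 : 1 < q by exact: le_lt_trans Nq.
have gq : gauss q * (q * q) <= 1.
  have := gauss_le q; have D : 0 < 1 + q ^+ 2 by have := sqr_ge0 q; lra.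
  rewrite -[_^-1]mul1r ler_pdivlMr// mulrDr mulr1 -expr2.
  by have := gauss_gt0 q; lra.
have g0 := gauss_gt0 q.
have Ae : A + 1 < e * q.
  rewrite mulrC -ltr_pdivrMr//; apply: lt_trans Nq; rewrite /N; lra.
have key : (A + 1) * gauss q * q < e.
  have : (A + 1) * gauss q * q * q <= A + 1.
    have -> : (A + 1) * gauss q * q * q = (A + 1) * (gauss q * (q * q)) by ring.
    by rewrite ler_piMr//; lra.
  move=> h; have q0 : 0 < q by lra.
  by rewrite -(ltr_pM2r q0); apply: le_lt_trans Ae.
have le1 := excess_le y; rewrite -/q in le1.
have ge0 := normr_ge0 (excess A y).
split.
  apply: (le_lt_trans le1); apply: le_lt_trans key.
  by rewrite ler_peMr ?(ltW q1)//; apply: mulr_ge0; [lra|exact: ltW].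
rewrite normrM [`|q|]gtr0_norm; last by lra.
by apply: le_lt_trans key; rewrite ler_wpM2r//; lra.
Qed.

Lemma excess_width : excess A (width A) = 0.
Proof. by rewrite /excess amplitude_width mul0r. Qed.

Lemma excess_continuous y : 0 <= y -> {for y, continuous (excess A)}.
Proof.
move=> y0; have [->|yw] := eqVneq y (width A).
  apply/cvgrPdist_lt => e e0; apply: filterS (excess_slope_width e0) => z [h _].
  by rewrite excess_width sub0r normrN.
have cs : {for y, continuous (slope A)}.
  move: y0; rewrite le_eqVlt => /predU1P[<-|y0]; first exact: continuous_slope0.
  exact: continuous_slope.
apply: cvgM; last exact: (cvg_comp _ _ cs (@continuous_gauss _ _)).
apply: cvg_near_cst; move: yw; rewrite neq_lt => /orP[yl|yr].
  apply: filterS (lt_nbhsl yl) => z zw; by rewrite !amplitude_bump.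
by apply: filterS (lt_nbhsr yr) => z zw; rewrite !amplitude_tail.
Qed.

Lemma excess_abs_continuous : continuous (fun x => excess A `|x|).
Proof.
move=> x; apply: (@continuous_comp _ _ _ (fun y : R => `|y|) (excess A)).
  exact: norm_continuous.
exact: excess_continuous.
Qed.

Lemma waveE x : wave A x = Num.sqrt (1 + excess A `|x|) / m.
Proof. by []. Qed.

Lemma wave_continuous : continuous (wave A).
Proof.
move=> x; apply: cvgM; last exact: cvg_cst.
apply: (@continuous_comp _ _ _ (fun x => 1 + excess A `|x|) Num.sqrt).
  by apply: cvgD; [exact: cvg_cst|exact: excess_abs_continuous].
exact: sqrt_continuous.
Qed.

Lemma slope_abs_bound x : `|Num.sg x * (excess A `|x| * slope A `|x|)|
  <= `|excess A `|x| * slope A `|x| |.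
Proof.
by rewrite normrM normr_sg ler_piMl//; case: (x != 0); rewrite ?lexx ?ler01.
Qed.

Lemma excess_slope_continuous y : 0 <= y ->
  {for y, continuous (fun y => excess A y * slope A y)}.
Proof.
move=> y0; have [->|yw] := eqVneq y (width A).
  apply/cvgrPdist_lt => e e0; apply: filterS (excess_slope_width e0) => z [_ h].
  by rewrite slope_width mulr0 sub0r normrN.
apply: cvgM; first exact: excess_continuous.
move: y0; rewrite le_eqVlt => /predU1P[<-|y0]; first exact: continuous_slope0.
exact: continuous_slope.
Qed.

Lemma signed_flux_continuous : continuous (fun x => Num.sg x * (excess A `|x| * slope A `|x|)).
Proof.
move=> x; have cP : {for x, continuous (fun x => excess A `|x| * slope A `|x|)}.
  apply: (@continuous_comp _ _ _ (fun y : R => `|y|) (fun y => excess A y * slope A y)).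
    exact: norm_continuous.
  exact: excess_slope_continuous.
(* The sign jumps at 0. Where the product vanishes, |sg| <= 1 is enough; elsewhere x is nonzero and
   the sign is locally constant. *)
have [P0|P0] := eqVneq (excess A `|x| * slope A `|x|) 0.
  apply/cvgrPdist_lt => e e0; move/cvgrPdist_lt/(_ e e0): cP.
  apply: filterS => y; rewrite P0 mulr0 !sub0r !normrN.
  exact/le_lt_trans/slope_abs_bound.
apply: cvgM cP; apply: cvg_near_cst; apply: near_sg.
by apply: contraNneq P0 => ->; rewrite [`|0 : R|]normr0 slope0 mulr0.
Qed.

Lemma flux_continuous : continuous (flux A).
Proof.
move=> x; have -> : flux A = fun x => k / m * (Num.sg x * (excess A `|x| * slope A `|x|)).
  by apply/funext => y; rewrite fluxE.
by apply: cvgM; [exact: cvg_cst|exact: signed_flux_continuous].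
Qed.

Lemma wave_tail x : width A < `|x| -> wave A x <= slope A `|x| / m.
Proof.
move=> wx; rewrite waveE ler_wpM2r ?invr_ge0 ?(ltW m_gt0)//.
rewrite -[leRHS](ger0_norm (slope_ge0 k A _)) -[leRHS]sqrtr_sqr ler_wsqrtr//.
rewrite /excess amplitude_tail// mulN1r.
by have := expR_ge1Dx (- slope A `|x| ^+ 2); rewrite -/(gauss _); lra.
Qed.

Lemma wave_ge0 x : 0 <= wave A x.
Proof. by rewrite waveE divr_ge0 ?sqrtr_ge0 ?(ltW m_gt0). Qed.

Lemma wave_gt0 x : 0 < wave A x.
Proof.
rewrite waveE divr_gt0// sqrtr_gt0.
have [x0|x0] := eqVneq `|x| 0.
  rewrite x0 /excess amplitude_bump ?width_gt0//.
  by have := A_gt0; have := gauss_gt0 (slope A 0); nra.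
have [->|xw] := eqVneq `|x| (width A).
  by rewrite /excess amplitude_width mul0r addr0.
apply: height2_gt0; first exact: amplitude_geN1.
by rewrite gt_eqF// slope_gt0// lt_neqAle eq_sym x0 normr_ge0.
Qed.

Lemma wave_vanishes : vanishes_at_infinity (wave A).
Proof.
move=> e e0; have [N wN HN] := slope_infty k_gt0 A_gt0 (mulr_gt0 e0 m_gt0).
exists N => x Nx; rewrite ger0_norm ?wave_ge0//.
apply: (le_lt_trans (wave_tail (lt_le_trans wN Nx))).
by rewrite ltr_pdivrMr//; exact: HN.
Qed.

Lemma flux_vanishes : vanishes_at_infinity (flux A).
Proof.
move=> e e0; have A0 := A_gt0; have e1 : 0 < e / (k / m * (A + 1)).
  by apply: divr_gt0 => //; apply: mulr_gt0; [exact: divr_gt0|lra].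
have [N wN HN] := slope_infty k_gt0 A_gt0 e1.
exists N => x Nx; rewrite fluxE normrM [`|k / m|]gtr0_norm ?divr_gt0//.
have km : 0 < k / m by exact: divr_gt0.
have q0 := slope_ge0 k A `|x|.
apply: (@le_lt_trans _ _ (k / m * (A + 1) * slope A `|x|)); last first.
  rewrite mulrC -ltr_pdivlMr; first exact: HN.
  by apply: mulr_gt0 km _; lra.
rewrite -mulrA ler_pM2l//; apply: (le_trans (slope_abs_bound x)).
rewrite normrM [`|slope _ _|]ger0_norm// ler_wpM2r//.
apply: (le_trans (excess_le _)); rewrite ler_piMr//; first by lra.
exact: gauss_le1.
Qed.

Lemma excess_lt y : 0 < y -> excess A y < A.
Proof.
move=> y0; rewrite /excess.
have [->|yw] := eqVneq y (width A); first by rewrite amplitude_width mul0r.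
have q0 := slope_gt0 k_gt0 A_gt0 y0 yw.
have g1 : gauss (slope A y) < 1 by apply: gauss_lt1; rewrite gt_eqF.
have g0 := gauss_gt0 (slope A y).
by have A0 := A_gt0; have /andP[a b] := amplitude_admissible k y A_gt0; nra.
Qed.

Lemma excess0 : excess A 0 = A.
Proof.
by rewrite /excess amplitude_bump ?width_gt0// slope0 /gauss expr0n oppr0 expR0 mulr1.
Qed.

Lemma excess_neq0 y : 0 < y -> y != width A -> excess A y != 0.
Proof.
move=> y0 yw; rewrite /excess mulf_neq0 ?(gt_eqF (gauss_gt0 _))//.
move: yw; rewrite neq_lt => /orP[yl|yr].
  by rewrite amplitude_bump// gt_eqF.
by rewrite amplitude_tail// oppr_eq0 oner_eq0.
Qed.

Lemma wave_inj x y : wave A x = wave A y -> excess A `|x| = excess A `|y|.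
Proof.
move=> E; apply: (@addrI _ 1); transitivity (m ^+ 2 * wave A x ^+ 2).
  exact/esym/sqr_wave.
by rewrite E; exact: sqr_wave.
Qed.

(** The maximum is attained only at 0 and the level m u = 1 only at the gluing points, so the values
    at the kinks are exceptional, as [weak_by_parts] requires. The flux meets the same condition by
    vanishing exactly at the kinks. *)
Lemma wave_off_kinks x : x \notin kinks A ->
  wave A x \notin 0 :: map (wave A) (kinks A).
Proof.
move=> /notin_kinks[x0 x_gt0 xw].
rewrite /= !inE gt_eqF ?wave_gt0//= !negb_or.
apply/and3P; split; apply/eqP => /wave_inj.
- by rewrite normr0 excess0 => E; have := excess_lt x_gt0; rewrite E ltxx.
- rewrite [`|width A|]gtr0_norm; last exact: width_gt0.
  rewrite excess_width => E.
  by have := excess_neq0 x_gt0 xw; rewrite E eqxx.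
- rewrite normrN [`|width A|]gtr0_norm; last exact: width_gt0.
  rewrite excess_width => E.
  by have := excess_neq0 x_gt0 xw; rewrite E eqxx.
Qed.

Lemma flux_off_kinks x : x \notin kinks A ->
  flux A x \notin 0 :: map (flux A) (kinks A).
Proof.
move=> /notin_kinks[x0 x_gt0 xw].
have w0 := width_gt0 k_gt0 A_gt0.
have -> : map (flux A) (kinks A) = [:: 0; 0; 0].
  rewrite /= !fluxE sgr0 mul0r normrN gtr0_norm// slope_width !mulr0.
  by [].
have : flux A x != 0.
  rewrite fluxE; apply: mulf_neq0; first by rewrite gt_eqF// divr_gt0.
  apply: mulf_neq0; first by rewrite sgr_eq0.
  apply: mulf_neq0; first exact: excess_neq0.
  by rewrite gt_eqF//; exact: slope_gt0.
by rewrite !inE => /negPf ->.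
Qed.

Lemma wave_le0 x : wave A x <= wave A 0.
Proof.
have le_excess : excess A `|x| <= excess A `|0 : R|.
  have [->|x0] := eqVneq x 0; first exact: lexx.
  rewrite [`|0 : R|]normr0 excess0; apply/ltW/excess_lt.
  by rewrite normr_gt0.
rewrite !waveE; apply: ler_wpM2r; first by rewrite invr_ge0; exact: ltW.
by apply: ler_wsqrtr; rewrite lerD2l.
Qed.

Lemma wave_single_humped : single_humped (wave A).
Proof.
exists 0; split; first exact: wave_le0.
move=> x H; have : wave A x = wave A 0.
  by apply: le_anti; apply/andP; split; [exact: wave_le0|exact: H].
move=> /wave_inj; rewrite [`|0 : R|]normr0 excess0 => E; apply/esym/eqP.
apply: contraT; rewrite -normr_gt0 => /excess_lt.
by rewrite E ltxx.
Qed.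

End FixedAmplitude.

End Wave.

(** * Strong L^2 convergence from pointwise convergence and convergence of norms *)

Section Scheffe.
Variable R : realType.
Notation mu := (@lebesgue_measure R).

(* For a, b of the same sign, (a - b)^2 <= |a^2 - b^2|, which equals
   a^2 - b^2 + 2 (b^2 - a^2)^+ with the positive part dominated by b^2. *)
Lemma scheffe_L2 (S : seq R) (u_ : nat -> R -> R) (u : R -> R) :
  (forall n, u_ n \in Lfun mu 2%:E) -> u \in Lfun mu 2%:E ->
  (forall x, x \notin S -> u_ n x @[n --> \oo] --> u x) ->
  (forall n x, 0 <= u_ n x * u x) ->
  \int[mu]_x (u_ n x ^+ 2) @[n --> \oo] --> \int[mu]_x (u x ^+ 2) ->
  \int[mu]_x ((u_ n x - u x) ^+ 2) @[n --> \oo] --> (0 : R).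
Proof.
move=> Lu_ Lu cvg_u sgn norm_u.
have mu_ n := Lfun2_measurable (Lu_ n); have mu0 := Lfun2_measurable Lu.
have iu_ n := Lfun2_integrable_sqr (Lu_ n); have iu := Lfun2_integrable_sqr Lu.
pose d n x := Num.max 0 (u x ^+ 2 - u_ n x ^+ 2).
have md n : measurable_fun setT (d n).
  apply: measurable_maxr; first exact: measurable_cst.
  by apply: measurable_funB; exact: measurable_funX.
have d_le n x : `|d n x| <= u x ^+ 2.
  rewrite ger0_norm ?le_max ?lexx//.
  by rewrite ge_max sqr_ge0/= gerBl sqr_ge0.
have id n : mu.-integrable setT (EFin \o d n).
  apply: (le_integrable measurableT _ _ iu).
    by apply/measurable_EFinP; exact: md.
  by move=> x _ /=; rewrite lee_fin (le_trans (d_le n x))// ler_norm.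
have d0 : \int[mu]_x d n x @[n --> \oo] --> (0 : R).
  have -> : (0 : R) = \int[mu]_x (cst 0 x : R).
    by rewrite /Rintegral integral0.
  apply: (@Rintegral_dominated _ S d (cst 0) (fun x => u x ^+ 2) md) => //.
  move=> x xS; have H : u x ^+ 2 - u_ n x ^+ 2 @[n --> \oo] --> (0 : R).
    rewrite -(subrr (u x ^+ 2)); apply: cvgB; first exact: cvg_cst.
    exact: (cvg_comp _ _ (cvg_u x xS) (@exprn_continuous R 2 _)).
  have cm : {for 0, continuous (fun y : R => Num.max 0 y)}.
    by apply: continuous_max; [exact: cvg_cst|exact: cvg_id].
  by have := cvg_comp _ _ H cm; rewrite maxxx.
have bound n : \int[mu]_x ((u_ n x - u x) ^+ 2) <=
    \int[mu]_x (u_ n x ^+ 2) - \int[mu]_x (u x ^+ 2) + 2 * \int[mu]_x d n x.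
  rewrite -RintegralB// -RintegralZl//.
  have i1 : mu.-integrable setT (EFin \o (fun x => u_ n x ^+ 2 - u x ^+ 2)).
    by have := integrableB measurableT (iu_ n) iu.
  have i2 : mu.-integrable setT (EFin \o (fun x => 2 * d n x)).
    by have := integrableZl measurableT 2 (id n).
  rewrite -RintegralD//.
  have i3 : mu.-integrable setT (EFin \o (fun x => u_ n x ^+ 2 - u x ^+ 2 + 2 * d n x)).
    by have := integrableD measurableT i1 i2.
  have le3 x : (u_ n x - u x) ^+ 2 <= u_ n x ^+ 2 - u x ^+ 2 + 2 * d n x.
    have h1 : 0 <= d n x by rewrite le_max lexx.
    have h2 : u x ^+ 2 - u_ n x ^+ 2 <= d n x by rewrite le_max lexx orbT.
    have := sgn n x; have [ab|ab] := leP (u x ^+ 2) (u_ n x ^+ 2).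
      by have := sqr_ge0 (u x); nra.
    by have := sqr_ge0 (u_ n x); nra.
  apply: le_Rintegral => //.
  apply: (le_integrable measurableT _ _ i3).
    by apply/measurable_EFinP; apply: measurable_funX; exact: (measurable_funB (mu_ n) mu0).
  by move=> x _ /=; rewrite lee_fin ger0_norm ?sqr_ge0// (le_trans (le3 x))// ler_norm.
apply: (@squeeze_cvgr _ _ _ _ (cst 0) (fun n => \int[mu]_x (u_ n x ^+ 2)
    - \int[mu]_x (u x ^+ 2) + 2 * \int[mu]_x d n x)).
- apply: nearW => n; rewrite bound andbT.
  by apply: Rintegral_ge0 => x _; exact: sqr_ge0.
- exact: cvg_cst.
- rewrite (_ : 0 = \int[mu]_x (u x ^+ 2) - \int[mu]_x (u x ^+ 2) + 2 * 0 :> R); last by ring.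
  apply: cvgD; first by apply: cvgB => //; exact: cvg_cst.
  by apply: cvgM => //; exact: cvg_cst.
Qed.

End Scheffe.

(** * Integrability of the wave, the weak equation, the energy and H^1 continuity *)

Section WaveIntegrals.
Variable R : realType.
Notation mu := (@lebesgue_measure R).
Variables (k m : R).
Hypotheses (k_gt0 : 0 < k) (m_gt0 : 0 < m).
Implicit Types (A q r x y : R).

Local Notation area := (area k).
Local Notation width := (width k).
Local Notation slope := (slope k).
Local Notation amplitude := (amplitude k).
Local Notation spread := (spread k).
Local Notation wave := (wave k m).
Local Notation wave_deriv := (wave_deriv k m).
Local Notation flux := (flux k m).
Local Notation flux_deriv := (flux_deriv k m).
Local Notation kinks := (kinks k).
Local Notation excess := (excess k).

(** m^2 u^2 as a function of q, the square of the height. *)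
Definition mass A q : R := 1 + A * gauss q.

Lemma continuous_expn n : continuous (fun q : R => q ^+ n).
Proof. exact: exprn_continuous. Qed.

Lemma continuous_mass A : continuous (mass A).
Proof.
move=> q; apply: cvgD; first exact: cvg_cst.
by apply: cvgM; [exact: cvg_cst|exact: continuous_gauss].
Qed.

Lemma mass_ge0 A q : -1 <= A -> 0 <= mass A q.
Proof. by move=> A1; rewrite /mass; have := gauss_gt0 q; have := gauss_le1 q; nra. Qed.

Lemma bump_sqr_bounded A : 0 < A -> bounded_range (area A 1 (fun q => q ^+ 2)).
Proof.
move=> A0; apply: (@bump_area_bounded _ _ k_gt0 A _ 1 A0 (@continuous_expn 2)) => q _.
by have := sqr_ge0 q; rewrite mul1r => h; nra.
Qed.

(** The fourth power of u' is what puts u u'^2, hence the derivative of the flux, in L^2. *)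
Lemma bump_quart_bounded A : 0 < A -> bounded_range (area A 1 (fun q => q ^+ 4)).
Proof.
move=> A0; apply: (@bump_area_bounded _ _ k_gt0 A _ 1 A0 (@continuous_expn 4)) => q _.
have -> : q ^+ 4 = (q ^+ 2) ^+ 2 by rewrite -exprM.
by have := sqr_ge0 q; rewrite mul1r => h; nra.
Qed.

Lemma bump_mass_bounded A : 0 < A -> bounded_range (area A 1 (mass A)).
Proof.
move=> A0; apply: (@bump_area_bounded _ _ k_gt0 A _ (1 + A) A0 (@continuous_mass A)) => q _.
rewrite mass_ge0; last by lra.
rewrite /mass; have := sqr_ge0 q; have := gauss_gt0 q; have := gauss_le1 q.
by move=> g1 g0 q0; nra.
Qed.

Lemma tail_sqr_bounded : bounded_range (area (-1) (-1) (fun q => q ^+ 2)).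
Proof.
apply: (@tail_area_bounded _ _ k_gt0 _ 1 (@continuous_expn 2)) => q _.
by have := sqr_ge0 q; rewrite mul1r => h; nra.
Qed.

Lemma tail_quart_bounded : bounded_range (area (-1) (-1) (fun q => q ^+ 4)).
Proof.
apply: (@tail_area_bounded _ _ k_gt0 _ 1 (@continuous_expn 4)) => q _.
have -> : q ^+ 4 = (q ^+ 2) ^+ 2 by rewrite -exprM.
by have := sqr_ge0 q; rewrite mul1r => h; nra.
Qed.

(** 1 - exp(-q^2) <= q^2 supplies the vanishing at q = 0 that the infinite tail demands. *)
Lemma tail_mass_bounded : bounded_range (area (-1) (-1) (mass (-1))).
Proof.
apply: (@tail_area_bounded _ _ k_gt0 _ 1 (@continuous_mass (-1))) => q _.
rewrite mass_ge0//= /mass; have := sqr_ge0 q.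
by have := expR_ge1Dx (- q ^+ 2); rewrite -/(gauss q) => h1 h2; nra.
Qed.

Lemma spread_ge0 A (h1 h2 : R -> R) y : (forall q, 0 <= h1 q) -> (forall q, 0 <= h2 q) ->
  0 <= spread A h1 h2 y.
Proof. by move=> p1 p2; rewrite /spread; repeat case: ifP => _. Qed.

Lemma integrable_spread A (h1 h2 : R -> R) : 0 < A ->
  continuous h1 -> continuous h2 -> (forall q, 0 <= h1 q) -> (forall q, 0 <= h2 q) ->
  bounded_range (area A 1 h1) -> bounded_range (area (-1) (-1) h2) ->
  mu.-integrable setT (EFin \o (fun x => spread A h1 h2 `|x|)).
Proof.
move=> A0 c1 c2 p1 p2 b1 b2; apply/integrableP; split.
  by apply/measurable_EFinP; exact: measurable_spread.
have -> : (\int[mu]_x `|(EFin \o (fun x => spread A h1 h2 `|x|)) x| =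
    \int[mu]_x (spread A h1 h2 `|x|)%:E)%E.
  by apply: eq_integral => x _ /=; rewrite ger0_norm// spread_ge0.
by rewrite profile_integral// ltry.
Qed.

Lemma sqr_wave_deriv A x : 0 < A ->
  wave_deriv A x ^+ 2 = (k / m) ^+ 2 * spread A (fun q => q ^+ 2) (fun q => q ^+ 2) `|x|.
Proof.
move=> A0; rewrite /wave_deriv exprMn sqrrN; congr (_ * _).
rewrite exprMn /spread; have [->|x0] := eqVneq x 0.
  rewrite sgr0 [`|0 : R|]normr0 ltxx/= ltNge ltW ?width_gt0//=.
  by rewrite expr0n mul0r.
rewrite sqr_sg x0 mul1r normr_gt0 x0/=.
have [xw|xw|->] := ltgtP `|x| (width A) => //.
by rewrite slope_width expr0n.
Qed.

Lemma quart_wave_deriv A x : 0 < A ->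
  wave_deriv A x ^+ 4 = (k / m) ^+ 4 * spread A (fun q => q ^+ 4) (fun q => q ^+ 4) `|x|.
Proof.
move=> A0; have -> : wave_deriv A x ^+ 4 = (wave_deriv A x ^+ 2) ^+ 2 by rewrite -exprM.
rewrite sqr_wave_deriv// exprMn -exprM; congr (_ * _).
by rewrite /spread; repeat case: ifP => _; rewrite -?exprM ?expr0n.
Qed.

Lemma sqr_wave_spread A x : 0 < A -> x \notin kinks A ->
  wave A x ^+ 2 = m ^- 2 * spread A (mass A) (mass (-1)) `|x|.
Proof.
move=> A0 xS; have [x0 x_gt0 xw] := notin_kinks xS.
have m2 : m ^+ 2 != 0 by rewrite expf_neq0// gt_eqF.
apply: (mulfI m2); rewrite sqr_wave// mulrA divff// mul1r.
rewrite /spread x_gt0 /excess /mass; move: xw.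
rewrite neq_lt => /orP[xl|xr]; first by rewrite xl/= amplitude_bump.
by rewrite [_ < width A]ltNge (ltW xr)/= xr amplitude_tail.
Qed.

Lemma measurable_wave_deriv A : 0 < A -> measurable_fun setT (wave_deriv A).
Proof.
move=> A0; apply: (@measurable_continuous_off _ (kinks A)) => x.
exact: continuous_wave_deriv.
Qed.

Lemma measurable_wave A : 0 < A -> measurable_fun setT (wave A).
Proof. by move=> A0; apply: continuous_measurable_fun; exact: wave_continuous. Qed.

Lemma sqr_integrable A : 0 < A -> mu.-integrable setT
  (EFin \o (fun x => spread A (fun q => q ^+ 2) (fun q => q ^+ 2) `|x|)).
Proof.
move=> A0; apply: integrable_spread => //.
- exact: continuous_expn.
- exact: continuous_expn.
- by move=> q; exact: sqr_ge0.
- by move=> q; exact: sqr_ge0.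
- exact: bump_sqr_bounded.
- exact: tail_sqr_bounded.
Qed.

Lemma mass_integrable A : 0 < A -> mu.-integrable setT
  (EFin \o (fun x => spread A (mass A) (mass (-1)) `|x|)).
Proof.
move=> A0; apply: integrable_spread => //.
- exact: continuous_mass.
- exact: continuous_mass.
- by move=> q; apply: mass_ge0; lra.
- by move=> q; exact: mass_ge0.
- exact: bump_mass_bounded.
- exact: tail_mass_bounded.
Qed.

Lemma quart_integrable A : 0 < A -> mu.-integrable setT
  (EFin \o (fun x => spread A (fun q => q ^+ 4) (fun q => q ^+ 4) `|x|)).
Proof.
move=> A0; apply: integrable_spread => //.
- exact: continuous_expn.
- exact: continuous_expn.
- by move=> q; rewrite -[4%N]/(2 * 2)%N exprM; exact: sqr_ge0.
- by move=> q; rewrite -[4%N]/(2 * 2)%N exprM; exact: sqr_ge0.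
- exact: bump_quart_bounded.
- exact: tail_quart_bounded.
Qed.

Lemma wave_Lfun2 A : 0 < A -> wave A \in Lfun mu 2%:E.
Proof.
move=> A0; apply: Lfun2P; first exact: measurable_wave.
apply: (@integrable_eq_off _ (kinks A) _ _ _ (integrable_scale (m ^- 2) (mass_integrable A0))).
by move=> x xS /=; rewrite sqr_wave_spread.
Qed.

Lemma wave_deriv_Lfun2 A : 0 < A -> wave_deriv A \in Lfun mu 2%:E.
Proof.
move=> A0; apply: Lfun2P; first exact: measurable_wave_deriv.
have -> : (fun x => wave_deriv A x ^+ 2) =
    (fun x => (k / m) ^+ 2 * spread A (fun q => q ^+ 2) (fun q => q ^+ 2) `|x|).
  by apply/funext => x; rewrite sqr_wave_deriv.
exact/integrable_scale/sqr_integrable.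
Qed.

Lemma wave_sqr_le A x : 0 < A -> wave A x ^+ 2 <= (2 + A) / m ^+ 2.
Proof.
move=> A0; rewrite ler_pdivlMr ?exprn_gt0// mulrC sqr_wave//.
have := excess_le k A0 `|x|; have := gauss_le1 (slope A `|x|).
by rewrite ler_norml => g1 /andP[_ h]; nra.
Qed.

Lemma wave_wave_deriv2_Lfun2 A : 0 < A ->
  (fun x => wave A x * wave_deriv A x ^+ 2) \in Lfun mu 2%:E.
Proof.
move=> A0; have mwd := measurable_wave_deriv A0.
have mf : measurable_fun setT (fun x => wave A x * wave_deriv A x ^+ 2).
  by apply: measurable_funM; [exact: measurable_wave|exact: measurable_funX].
apply: Lfun2P => //.
pose C := (2 + A) / m ^+ 2 * (k / m) ^+ 4.
apply: (le_integrable measurableT _ _ (integrable_scale C (quart_integrable A0))).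
  by apply/measurable_EFinP; exact: measurable_funX.
move=> x _ /=; rewrite lee_fin ger0_norm ?sqr_ge0//.
apply: le_trans (ler_norm _); rewrite /C -mulrA -quart_wave_deriv// exprMn -exprM.
apply: ler_wpM2r; last exact: wave_sqr_le.
by rewrite exprM; exact: sqr_ge0.
Qed.

Lemma flux_Lfun2 A : 0 < A -> flux A \in Lfun mu 2%:E.
Proof.
move=> A0; apply: Lfun2P.
  by apply: continuous_measurable_fun; exact: flux_continuous.
apply: (le_integrable measurableT _ _
  (integrable_scale ((A + 1) ^+ 2) (Lfun2_integrable_sqr (wave_deriv_Lfun2 A0)))).
  apply/measurable_EFinP; apply: measurable_funX.
  by apply: continuous_measurable_fun; exact: flux_continuous.
move=> x _ /=; rewrite lee_fin ger0_norm ?sqr_ge0//.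
apply: le_trans (ler_norm _); rewrite /flux sqr_wave// exprMn.
apply: ler_wpM2r; first exact: sqr_ge0.
have := excess_le k A0 `|x|; have := gauss_le1 (slope A `|x|).
rewrite opprD addrA subrr sub0r sqrrN => g1; rewrite ler_norml => /andP[h1 h2].
have g0 := gauss_gt0 (slope A `|x|).
have {}h1 : - (A + 1) <= excess A `|x| by nra.
have {}h2 : excess A `|x| <= A + 1 by nra.
nra.
Qed.

Lemma flux_deriv_Lfun2 A : 0 < A -> flux_deriv A \in Lfun mu 2%:E.
Proof.
move=> A0; have Lu := wave_Lfun2 A0; have Luv := wave_wave_deriv2_Lfun2 A0.
have mf : measurable_fun setT (flux_deriv A).
  apply: measurable_funB; apply: measurable_funM; first exact: measurable_cst.
  - exact: Lfun2_measurable.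
  - exact: measurable_cst.
  - exact: Lfun2_measurable Luv.
apply: Lfun2P => //.
have i1 := Lfun2_integrable_sqr (Lfun2_scale (k ^+ 2) Lu).
have i2 := Lfun2_integrable_sqr (Lfun2_scale (2 * m ^+ 2) Luv).
have i3 := integrableD measurableT (integrable_scale 2 i1) (integrable_scale 2 i2).
apply: (le_integrable measurableT _ _ i3).
  by apply/measurable_EFinP; exact: measurable_funX.
move=> x _ /=; rewrite lee_fin ger0_norm ?sqr_ge0//; apply: le_trans (ler_norm _).
rewrite /flux_deriv; set a := k ^+ 2 * _; set d := 2 * m ^+ 2 * _.
by have := sqr_ge0 (a + d); lra.
Qed.

Lemma wave_H1 A : 0 < A -> H1_with (wave A) (wave_deriv A).
Proof.
move=> A0; apply: (@H1_with_off _ (kinks A)).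
- exact: wave_continuous.
- exact: wave_vanishes.
- by move=> x; exact: is_derive_wave.
- by move=> x; exact: continuous_wave_deriv.
- by move=> x; exact: wave_off_kinks.
- exact: wave_Lfun2.
- exact: wave_deriv_Lfun2.
Qed.

Lemma wave_weak_solution A : 0 < A -> weak_solution (k ^+ 2) (m ^+ 2) (wave A).
Proof.
move=> A0; exists (wave_deriv A); first exact: wave_H1.
move=> phi psi [Lphi Lpsi wphi].
have -> : inner_L2 (fun x => (1 - m ^+ 2 * wave A x ^+ 2) * wave_deriv A x) psi
    = inner_L2 (flux A) psi by [].
have -> : inner_L2 (flux A) psi = - inner_L2 (flux_deriv A) phi.
  apply: (@weak_by_parts _ (kinks A)).
  - exact: flux_continuous.
  - exact: flux_vanishes.
  - by move=> x; exact: is_derive_flux_wave.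
  - by move=> x; exact: continuous_flux_deriv.
  - by move=> x; exact: flux_off_kinks.
  - exact: flux_Lfun2.
  - exact: flux_deriv_Lfun2.
  - exact: Lphi.
  - exact: Lpsi.
  - exact: wphi.
have i1 := Lfun2_integrableM (wave_Lfun2 A0) Lphi.
have i2 := Lfun2_integrableM (wave_wave_deriv2_Lfun2 A0) Lphi.
have -> : inner_L2 (flux_deriv A) phi = k ^+ 2 * inner_L2 (wave A) phi
    - 2 * m ^+ 2 * \int[mu]_x (wave A x * wave_deriv A x ^+ 2 * phi x).
  rewrite /inner_L2 -RintegralZl// -RintegralZl// -RintegralB//.
  - by apply: eq_Rintegral => x _; rewrite /flux_deriv; ring.
  - exact: integrable_scale.
  - exact: integrable_scale.
by ring.
Qed.

(** log|1 - b u^2| = ln|A| - q^2. The constant ln A is integrable because the crest is bounded, ln 1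
    = 0 on the tails, and q^2 is integrable on both. At the gluing points, a null set, the logarithm
    is -oo. *)
Lemma wave_energy A : 0 < A -> energy_space (m ^+ 2) (wave A).
Proof.
move=> A0; split; first by exists (wave_deriv A); exact: wave_H1.
pose L x : R := ln A * spread A (fun=> 1) (fun=> 0) `|x|
  + (-1) * spread A (fun q => q ^+ 2) (fun q => q ^+ 2) `|x|.
have iL : mu.-integrable setT (EFin \o L).
  have i1 : mu.-integrable setT (EFin \o (fun x => spread A (fun=> 1) (fun=> 0) `|x|)).
    apply: integrable_spread => //.
    - exact: cst_continuous.
    - exact: cst_continuous.
    - exact: bump_bounded.
    - apply: (@tail_area_bounded _ _ k_gt0 (fun=> 0) 1); first exact: cst_continuous.
      by move=> q _; rewrite lexx/= mul1r mulr_ge0 ?sqr_ge0//; have := sqr_ge0 q; lra.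
  by have := integrableD measurableT (integrable_scale (ln A) i1)
    (integrable_scale (-1) (sqr_integrable A0)).
rewrite (@integral_eq_off _ (kinks A) _ (EFin \o L)).
- have := integrable_fin_num measurableT iL.
  by rewrite fin_num_abs.
- exact: (measurable_int mu iL).
move=> x xS; have [x0 x_gt0 xw] := notin_kinks xS.
rewrite [`|wave A x|]ger0_norm ?wave_ge0// sqr_wave// opprD addrA subrr sub0r normrN.
have e0 : 0 < `|excess A `|x| | by rewrite normr_gt0 excess_neq0.
rewrite lne_EFin// /L /= /excess normrM [`|gauss _|]gtr0_norm ?gauss_gt0//.
rewrite /spread x_gt0; congr EFin; move: xw.
rewrite neq_lt => /orP[xl|xr].
  rewrite xl/= amplitude_bump// gtr0_norm//.
  by rewrite lnM ?posrE ?gauss_gt0// /gauss expRK; ring.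
rewrite [_ < width A]ltNge (ltW xr)/= xr amplitude_tail// normrN1 mul1r.
by rewrite /gauss expRK; ring.
Qed.

Lemma wave_solution A : 0 < A ->
  positive_single_humped_solution (k ^+ 2) (m ^+ 2) (wave A).
Proof.
move=> A0; split.
- exact: wave_continuous.
- exact: wave_weak_solution.
- by move=> x; exact: wave_gt0.
- exact: wave_single_humped.
Qed.

Lemma wave_even A x : wave A (- x) = wave A x.
Proof. by rewrite /wave normrN. Qed.

Lemma wave_max_inj A B a : 0 < A -> 0 < B ->
  (forall x, wave A (x + a) = wave B x) -> A = B.
Proof.
move=> A0 B0 H; have E : wave A 0 = wave B 0.
  apply: le_anti; apply/andP; split.
    have := wave_le0 k_gt0 m_gt0 B0 (- a); rewrite -H addNr; exact.
  have := wave_le0 k_gt0 m_gt0 A0 (0 + a); rewrite H; exact.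
have sq C : 0 < C -> m ^+ 2 * wave C 0 ^+ 2 = 1 + C.
  move=> C0; have := sqr_wave k m_gt0 C0 0.
  by rewrite [`|0 : R|]normr0 (excess0 k_gt0 C0).
by apply: (@addrI _ 1); rewrite -(sq A A0) -(sq B B0) E.
Qed.

Lemma total_area_sqr_cvg A0 : 0 < A0 ->
  total_area k A 1 (fun q => q ^+ 2) @[A --> A0] --> total_area k A0 1 (fun q => q ^+ 2).
Proof.
move=> A0_gt0.
have [||||_ h1 h2] := @area_family_cvg _ k k_gt0 (fun _ q => q ^+ 2) A0
  (256 * ((1 + (A0 + 1)) / k)) A0_gt0.
- by apply: mulr_ge0; [rewrite ler0n|apply: divr_ge0 (ltW k_gt0); lra].
- by move=> A _; exact: continuous_expn.
- exact: bump_sqr_bounded.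
- move=> A r A_gt0 AA0; apply: (@bump_density_close _ _ k_gt0 _ _ _ (fun q => q ^+ 2)) => //.
    by lra.
  by move=> q; have := sqr_ge0 q => h; nra.
exact: cvgB.
Qed.

Lemma total_area_mass_cvg A0 : 0 < A0 ->
  total_area k A 1 (mass A) @[A --> A0] --> total_area k A0 1 (mass A0).
Proof.
move=> A0_gt0.
have [||||_ h1 h2] := @area_family_cvg _ k k_gt0 mass A0
  (256 * ((1 + 2 * (A0 + 1)) / k)) A0_gt0.
- by apply: mulr_ge0; [rewrite ler0n|apply: divr_ge0 (ltW k_gt0); lra].
- by move=> A _; exact: continuous_mass.
- exact: bump_mass_bounded.
- by move=> A r A_gt0 AA0; apply: bump_height_close => //; lra.
exact: cvgB.
Qed.

Lemma Rintegral_sqr_wave_deriv A : 0 < A -> \int[mu]_x (wave_deriv A x ^+ 2)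
  = (k / m) ^+ 2 * (2 * (total_area k A 1 (fun q => q ^+ 2)
                        + total_area k (-1) (-1) (fun q => q ^+ 2))).
Proof.
move=> A0; have -> : (fun x => wave_deriv A x ^+ 2) =
    (fun x => (k / m) ^+ 2 * spread A (fun q => q ^+ 2) (fun q => q ^+ 2) `|x|).
  by apply/funext => x; rewrite sqr_wave_deriv.
rewrite RintegralZl//; last exact: sqr_integrable.
rewrite [X in _ * X]/Rintegral profile_integral//.
- exact: continuous_expn.
- exact: continuous_expn.
- by move=> q; exact: sqr_ge0.
- by move=> q; exact: sqr_ge0.
- exact: bump_sqr_bounded.
- exact: tail_sqr_bounded.
Qed.

Lemma Rintegral_sqr_wave A : 0 < A -> \int[mu]_x (wave A x ^+ 2)
  = m ^- 2 * (2 * (total_area k A 1 (mass A) + total_area k (-1) (-1) (mass (-1)))).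
Proof.
move=> A0; have ms := mass_integrable A0.
rewrite /Rintegral (@integral_eq_off _ (kinks A) _
  (fun x => (m ^- 2 * spread A (mass A) (mass (-1)) `|x|)%:E)); first last.
- by move=> x xS; rewrite sqr_wave_spread.
- exact: (measurable_int mu (integrable_scale (m ^- 2) ms)).
rewrite -/(Rintegral mu setT _) RintegralZl//.
rewrite [X in _ * X]/Rintegral profile_integral//.
- exact: continuous_mass.
- exact: continuous_mass.
- by move=> q; apply: mass_ge0; lra.
- by move=> q; exact: mass_ge0.
- exact: bump_mass_bounded.
- exact: tail_mass_bounded.
Qed.

Lemma wave_cvg A0 x : 0 < A0 -> x \notin kinks A0 ->
  wave A x @[A --> A0] --> wave A0 x.
Proof.
move=> A0_gt0 /notin_kinks[x0 x_gt0 xw].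
have cs := slope_cvg k_gt0 A0_gt0 xw.
have ca := amplitude_cvg k_gt0 A0_gt0 x_gt0 xw.
have cE : 1 + amplitude A `|x| * gauss (slope A `|x|) @[A --> A0]
    --> 1 + amplitude A0 `|x| * gauss (slope A0 `|x|).
  apply: cvgD; first exact: cvg_cst.
  by apply: cvgM ca _; exact: (cvg_comp _ _ cs (@continuous_gauss _ _)).
apply: cvgM; last exact: cvg_cst.
exact: (cvg_comp _ _ cE (@sqrt_continuous R _)).
Qed.

Lemma wave_deriv_cvg A0 x : 0 < A0 -> x \notin kinks A0 ->
  wave_deriv A x @[A --> A0] --> wave_deriv A0 x.
Proof.
move=> A0_gt0 /notin_kinks[x0 x_gt0 xw].
apply: cvgM; first exact: cvg_cst.
by apply: cvgM; [exact: cvg_cst|exact: slope_cvg].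
Qed.

(** Stated for sequences because [scheffe_L2] rests on dominated convergence. Its sign condition
    holds: waves are positive, and their derivatives vanish or have the sign of -x. The exceptional
    points are the kinks of the limit alone. *)
Lemma wave_H1_cvg (A_ : nat -> R) A0 : (forall n, 0 < A_ n) -> 0 < A0 ->
  A_ n @[n --> \oo] --> A0 ->
  norm_H1 (wave (A_ n) \- wave A0) (wave_deriv (A_ n) \- wave_deriv A0) @[n --> \oo]
  --> (0 : R).
Proof.
move=> A_gt0 A0_gt0 cA.
have cu : \int[mu]_x ((wave (A_ n) x - wave A0 x) ^+ 2) @[n --> \oo] --> (0 : R).
  apply: (@scheffe_L2 _ (kinks A0) (fun n => wave (A_ n)) (wave A0)).
  - by move=> n; exact: wave_Lfun2.
  - exact: wave_Lfun2.
  - by move=> x xS; exact: (cvg_comp _ _ cA (wave_cvg A0_gt0 xS)).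
  - by move=> n x; rewrite mulr_ge0 ?wave_ge0.
  - under eq_fun do rewrite Rintegral_sqr_wave//.
    rewrite Rintegral_sqr_wave//; apply: cvgM; first exact: cvg_cst.
    apply: cvgM; first exact: cvg_cst.
    apply: cvgD; last exact: cvg_cst.
    exact: (cvg_comp _ _ cA (total_area_mass_cvg A0_gt0)).
have cv : \int[mu]_x ((wave_deriv (A_ n) x - wave_deriv A0 x) ^+ 2) @[n --> \oo] --> (0 : R).
  apply: (@scheffe_L2 _ (kinks A0) (fun n => wave_deriv (A_ n)) (wave_deriv A0)).
  - by move=> n; exact: wave_deriv_Lfun2.
  - exact: wave_deriv_Lfun2.
  - by move=> x xS; exact: (cvg_comp _ _ cA (wave_deriv_cvg A0_gt0 xS)).
  - move=> n x; rewrite /wave_deriv.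
    set q1 := slope (A_ n) _; set q2 := slope A0 _.
    have -> : - (k / m) * (Num.sg x * q1) * (- (k / m) * (Num.sg x * q2))
      = ((k / m) * Num.sg x) ^+ 2 * (q1 * q2) by ring.
    by apply: mulr_ge0; [exact: sqr_ge0|apply: mulr_ge0; exact: slope_ge0].
  - under eq_fun do rewrite Rintegral_sqr_wave_deriv//.
    rewrite Rintegral_sqr_wave_deriv//; apply: cvgM; first exact: cvg_cst.
    apply: cvgM; first exact: cvg_cst.
    apply: cvgD; last exact: cvg_cst.
    exact: (cvg_comp _ _ cA (total_area_sqr_cvg A0_gt0)).
have cuv : \int[mu]_x ((wave (A_ n) x - wave A0 x) ^+ 2)
    + \int[mu]_x ((wave_deriv (A_ n) x - wave_deriv A0 x) ^+ 2) @[n --> \oo] --> (0 : R).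
  by rewrite -[X in _ --> X](addr0 0); exact: cvgD.
have := cvg_comp _ _ cuv (@sqrt_continuous R 0); rewrite sqrtr0.
apply: cvg_trans; apply: near_eq_cvg; apply: nearW => n /=.
by rewrite /norm_H1 /inner_L2; congr Num.sqrt; congr (_ + _);
  apply: eq_Rintegral => x _ /=; rewrite expr2.
Qed.

Lemma wave_family_continuous : H1_continuous_family (fun t => wave (expR t)).
Proof.
exists (fun t => wave_deriv (expR t)); split.
  by move=> t; apply: wave_H1; exact: expR_gt0.
move=> t0; apply/(@cvg_nbhsP _ R^o) => u ut.
apply: (@wave_H1_cvg (fun n => expR (u n)) (expR t0)).
- by move=> n; exact: expR_gt0.
- exact: expR_gt0.
- exact: (cvg_comp _ _ ut (@continuous_expR R t0)).
Qed.

End WaveIntegrals.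

(** * Nonexistence for negative b, and the conclusion *)

Lemma no_solution_neg (R : realType) (c b : R) (u : R -> R) : 0 < c -> b < 0 ->
  weak_solution c b u -> ~ positive_fun u.
Proof.
move=> c0 b0 [v [Lu Lv wuv] H] upos.
have := H u v (And3 Lu Lv wuv).
set I1 := inner_L2 u u; set I2 := inner_L2 _ v; set I3 := Rintegral _ _ _ => E.
(* The signs of [I2] and [I3] come from those of the integrands, by b < 0 and u > 0; then E forces
   the integral of u^2 to be 0. *)
have I2_ge0 : 0 <= I2.
  apply: Rintegral_ge0 => x _; rewrite -mulrA -expr2 mulr_ge0 ?sqr_ge0//.
  by have := sqr_ge0 (u x); nra.
have I3_ge0 : 0 <= I3.
  apply: Rintegral_ge0 => x _; have u0 := ltW (upos x).
  by apply: mulr_ge0 => //; apply: mulr_ge0 => //; exact: sqr_ge0.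
have I1_ge0 : 0 <= I1 by apply: Rintegral_ge0 => x _; rewrite -expr2 sqr_ge0.
have I1_0 : I1 = 0 by nra.
have iu := Lfun2_integrableM Lu Lu.
have mf := measurable_int _ iu.
have : (\int[lebesgue_measure]_x `|(EFin \o (fun x => u x * u x)%R) x| = 0)%E.
  have -> : (\int[lebesgue_measure]_x `|(EFin \o (fun x => u x * u x)%R) x|
      = \int[lebesgue_measure]_x (u x * u x)%:E)%E.
    by apply: eq_integral => x _ /=; rewrite ger0_norm// -expr2 sqr_ge0.
  rewrite -[LHS]fineK ?(integrable_fin_num measurableT iu)//.
  by rewrite -/(Rintegral _ _ _) -/(inner_L2 u u) -/I1 I1_0.
move/(ae_eq_integral_abs lebesgue_measure measurableT mf) => [N [mN N0 HN]].
(* u^2 = 0 almost everywhere while u > 0 everywhere: the exceptional null set is the whole line,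
   which has infinite measure. *)
have : setT `<=` N.
  move=> x _; apply: HN => /= /(_ I) [] /eqP.
  by rewrite mulf_eq0 orbb gt_eqF// upos.
move=> TN; have NT : N = setT by apply/seteqP; split.
have := @lebesgue_measure_itv R `]-oo, +oo[%R; rewrite set_itvNyy -NT N0 /=.
by [].
Qed.

Theorem theorem1 (R : realType) (c : R) (hc : 0 < c) :
  (forall b : R, b < 0 ->
     ~ exists u : R -> R, positive_single_humped_solution c b u) /\
  (forall b : R, 0 < b ->
     exists U : R -> R -> R,
       [/\ forall t, positive_single_humped_solution c b (U t),
           forall t, energy_space b (U t),
           H1_continuous_family U,
           forall t x : R, U t (- x) = U t x
         & forall s t a : R, (forall x : R, U s (x + a) = U t x) -> s = t]).
Proof.
split=> [b b0 [u [_ hu upos _]]|b b0]; first exact: (no_solution_neg hc b0 hu).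
have k0 : 0 < Num.sqrt c by rewrite sqrtr_gt0.
have m0 : 0 < Num.sqrt b by rewrite sqrtr_gt0.
exists (fun t => wave (Num.sqrt c) (Num.sqrt b) (expR t)).
(* Only the c and b of the equation and of the energy space become squares; those under the square
   roots in the family stay. *)
rewrite -{1}(sqr_sqrtr (ltW hc)) -{1 3}(sqr_sqrtr (ltW b0)); split.
- by move=> t; apply: wave_solution => //; exact: expR_gt0.
- by move=> t; apply: wave_energy => //; exact: expR_gt0.
- exact: wave_family_continuous.
- by move=> t x; exact: wave_even.
- move=> s t a; move/(wave_max_inj k0 m0 (expR_gt0 s) (expR_gt0 t)).
  exact: expR_inj.
Qed.
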